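(* Every genus $3$ hyperelliptic curve with full automorphism group isomorphic to $\mathbb Z_2\times D_8$ has equation $$Y^2=tX^8+tX^4+1$$ for some $t\ne 0,4$. If $t\neq -140,\,-\frac{980}{3}$, then $$t=-28\,\frac{5t_4+28}{t_4-4}$$ in terms of the absolute invariants, and therefore the field of moduli is a field of definition.
   Context: Curves are over an algebraically closed field $k$ of characteristic zero; $D_8$ is the dihedral group of order $8$. For a binary octavic $f$, let $(\cdot,\cdot)^n$ be the classically normalized $n$-th transvection, and put $\kappa=(f,f)^6$, $h=(\kappa,\kappa)^2$, $J_2=2^2\cdot5\cdot7\,(f,f)^8$, $J_4=2^9\cdot3\cdot7^4\,(\kappa,\kappa)^4$, $J_6=2^{14}\cdot3^2\cdot7^6\,(\kappa,h)^4$. The absolute invariant $t_4$ of a curve $Y^2=F(X)$ is $t_4=J_6/(J_2J_4)$, evaluated at the degree $8$ homogenization of $F$. The field of moduli of a curve is the field of rationality of its moduli point (generated by its absolute invariants); a field of definition is a field over which some curve isomorphic to it has an equation. *)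

(* Defs.v *)
From HB Require Import structures.
From mathcomp Require Import all_boot all_order all_fingroup all_algebra.
From mathcomp Require Import all_solvable all_field.
From mathcomp Require Import polyXY mpoly.

Set Implicit Arguments.
Unset Strict Implicit.
Unset Printing Implicit Defensive.

Import GRing.Theory.
Local Open Scope ring_scope.

(* A curve over k is represented by its function field: a field K together    *)
(* with an embedding iota : k -> K.  Over an algebraically closed k, smooth   *)
(* projective curves up to isomorphism are the same thing as function fields  *)
(* of transcendence degree 1 up to k-isomorphism, and automorphisms of the    *)
(* curve are the k-automorphisms of K.                                        *)

Section Curves.

Variables (k K : fieldType) (iota : {rmorphism k -> K}).

(* In {poly {poly k}} the outer variable 'X plays the role of X and the inner *)
(* variable 'Y that of Y, as in polyXY.                                       *)
Definition eval_at (P : {poly {poly k}}) (u v : K) : K :=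
  (map_poly (map_poly iota) P).[u, v].

(* K = k(u, v) and P generates the ideal of relations between u and v, i.e.   *)
(* K is the function field of the integral plane curve P = 0, with coordinate *)
(* functions u and v.                                                         *)
Definition plane_model (P : {poly {poly k}}) (u v : K) : Prop :=
  [/\ P != 0,
      forall Q : {poly {poly k}},
        eval_at Q u v = 0 <-> exists A : {poly {poly k}}, Q = A * P
    & forall z : K, exists A B : {poly {poly k}},
        eval_at B u v != 0 /\ z = eval_at A u v / eval_at B u v].

Definition has_equation (P : {poly {poly k}}) : Prop :=
  exists u v : K, plane_model P u v.

Definition hyperelliptic_eqn (F : {poly k}) : {poly {poly k}} :=
  'Y ^+ 2 - map_poly polyC F.

(* Squarefree F of degree 7 or 8; degree 7 is the case where the octavic form *)
(* has a root at infinity.                                                    *)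
Definition genus3_hyperelliptic (F : {poly k}) : Prop :=
  [/\ separable_poly F, (size F == 8) || (size F == 9)
    & has_equation (hyperelliptic_eqn F)].

Definition full_aut_isog (gT : finGroupType) : Prop :=
  exists phi : gT -> {rmorphism K -> K},
    [/\ forall g, bijective (phi g) /\ (forall a, phi g (iota a) = iota a),
        forall g h, phi (g * h)%g =1 phi g \o phi h,
        forall g h, phi g =1 phi h -> g = h
      & forall s : {rmorphism K -> K},
          bijective s -> (forall a, s (iota a) = iota a) ->
          exists g, phi g =1 s].

Definition is_subfield (L : k -> Prop) : Prop :=
  L 1 /\ forall x y, L x -> L y -> L (x - y) /\ L (x / y).

Definition is_field_of_definition (L : k -> Prop) : Prop :=
  is_subfield L /\
  exists P : {poly {poly k}},
    (forall i j : nat, L P`_i`_j) /\ has_equation P.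

End Curves.

Section BinaryForms.

Variable k : fieldType.
Implicit Types (f g : {mpoly k[2]}) (F : {poly k}).

(* (f, g)^n for forms f of degree m and g of degree p. *)
Definition transvection (m p : nat) f g (n : nat) : {mpoly k[2]} :=
  (((m - n)`! * (p - n)`!)%N%:R / (m`! * p`!)%N%:R) *:
  \sum_(i < n.+1) ((-1) ^+ i * 'C(n, i)%:R) *:
     (f^`M(ord0, (n - i)%N)^`M(ord_max, i)
      * g^`M(ord0, i)^`M(ord_max, (n - i)%N)).

(* The degree 8 homogenization of F. *)
Definition octavic F : {mpoly k[2]} :=
  \sum_(i < 9) F`_i *: ('X_ord0 ^+ i * 'X_ord_max ^+ (8 - i)%N).

Definition kappa f := transvection 8 8 f f 6.
Definition hform f := transvection 4 4 (kappa f) (kappa f) 2.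

(* A transvection of total degree 0 is a constant polynomial; _@_0 is its     *)
(* value.                                                                     *)
Definition J2 f : k :=
  2%:R ^+ 2 * 5%:R * 7%:R * (transvection 8 8 f f 8)@_0%MM.
Definition J4 f : k :=
  2%:R ^+ 9 * 3%:R * 7%:R ^+ 4 * (transvection 4 4 (kappa f) (kappa f) 4)@_0%MM.
Definition J6 f : k :=
  2%:R ^+ 14 * 3%:R ^+ 2 * 7%:R ^+ 6
  * (transvection 4 4 (kappa f) (hform f) 4)@_0%MM.

Definition t4 F : k :=
  J6 (octavic F) / (J2 (octavic F) * J4 (octavic F)).

(* f(aX + bZ, cX + dZ) for M = (a b ; c d). *)
Definition subst_form (M : 'M[k]_2) f : {mpoly k[2]} :=
  f \mPo [tuple \sum_(j < 2) M i j *: 'X_j | i < 2].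

Definition octavic_coef f (i : 'I_9) : k :=
  f@_(U_(ord0) *+ i + U_(ord_max) *+ (8 - i)%N)%MM.

(* The value at f of a polynomial I in the nine coefficients of an octavic.   *)
Definition eval_inv (I : {mpoly int[9]}) f : k :=
  (map_mpoly (intr : int -> k) I).@[octavic_coef f].

Definition octavic_invariant (d : nat) (I : {mpoly int[9]}) : Prop :=
  I \is d.-homog /\
  forall (M : 'M[k]_2) f, f \is 8.-homog -> \det M = 1 ->
    eval_inv I (subst_form M f) = eval_inv I f.

(* The absolute invariants of Y^2 = F(X) are the values at F of the quotients *)
(* of two invariants of the same degree.  Integral coefficients are no        *)
(* restriction over rational ones, as denominators can be cleared.            *)
Definition absolute_invariant F (a : k) : Prop :=
  exists (d : nat) (I I' : {mpoly int[9]}),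
    [/\ octavic_invariant d I, octavic_invariant d I',
        eval_inv I' (octavic F) != 0
      & a = eval_inv I (octavic F) / eval_inv I' (octavic F)].

Definition field_of_moduli F (x : k) : Prop :=
  forall S : k -> Prop, is_subfield S ->
    (forall a, absolute_invariant F a -> S a) -> S x.

End BinaryForms.

(* Main.v *)
Require Import Defs.
From HB Require Import structures.
From mathcomp Require Import all_boot all_order all_fingroup all_algebra.
From mathcomp Require Import all_solvable all_field.
From mathcomp Require Import polyXY mpoly.
From mathcomp Require Import ring.

Set Implicit Arguments.
Unset Strict Implicit.
Unset Printing Implicit Defensive.

Import GRing.Theory.
Local Open Scope ring_scope.

(** A function field K of a hyperelliptic curve of genus three is a quadratic extension
    k(u, v) of a rational field k(u), with v^2 = F(u).  The argument rests on the
    uniqueness of the subfield k(u), equivalently of the hyperelliptic involution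
    (u, v) |-> (u, -v).  In general uniqueness uses differentials or an inequality on
    genera; here it follows by elementary means from the finiteness of the automorphism
    group, in which g^4 = 1 for all g ([hyp_inv_unique]).  The involution is therefore
    central, and the automorphism group acts on k(u) by Moebius transformations, because
    two generators of the same rational field are Moebius functions of each other
    ([moebius_of_mutual]).  A change of the coordinate u transforms the octavic F by a
    linear substitution, up to a constant factor ([moebius_transfer]).

    The group that acts faithfully on k(u) has order eight.  It cannot have exponent two
    ([exists_order4]), so some element acts as w |-> c w with c a primitive fourth root of
    unity, in a suitable coordinate w.  Then F only involves X^8, X^4 and 1, and a
    rescaling gives t X^8 + t X^4 + 1.  Here t is not 4, as the octavic is square-free, and
    t is not 0, as Y^2 = X^8 + 1 has an automorphism of order eight ([normal_form]).

    For the second part, uniqueness shows that any equation t X^8 + t X^4 + 1 of K is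
    equivalent to F under a linear substitution.  Transvectants are covariants, because
    powers of linear forms span all forms and the statement is clear for them
    ([transvection_subst]); so t4 takes the same value at F and at the normal form.
    There kappa is a multiple of X^2 Z^2, and t4 = 4 (t - 196) / (t + 140), which is a
    Moebius function of t that can be solved for t ([t_of_t4]).

    Finally J6 and J2 J4 are, up to a common integral factor, invariants with integral
    coefficients ([t4_absolute]), so t4 is an absolute invariant whenever J2 J4 does not
    vanish, and t lies in the field of moduli.  The only other value is t = 196, an
    integer.  So the normal form is defined over the field of moduli. *)

(** * Rational functions of one element *)

Section RationalFunctions.

Variables (k : closedFieldType) (K : fieldType) (iota : {rmorphism k -> K}).
Implicit Types (u v w z : K) (p q : {poly k}).

Definition ev u : {poly k} -> K := horner_eval u \o map_poly iota.

HB.instance Definition _ u := GRing.RMorphism.on (ev u).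

Lemma evE u p : ev u p = (map_poly iota p).[u].
Proof. by []. Qed.

Lemma evX u : ev u 'X = u.
Proof. by rewrite evE map_polyX hornerX. Qed.

Lemma evC u c : ev u c%:P = iota c.
Proof. by rewrite evE map_polyC hornerC. Qed.

Lemma evZ u c p : ev u (c *: p) = iota c * ev u p.
Proof. by rewrite -mul_polyC rmorphM /= evC. Qed.

Lemma ev_comp u p q : ev u (p \Po q) = ev (ev u q) p.
Proof. by rewrite evE map_comp_poly horner_comp. Qed.

Definition transcendental u := forall p, ev u p = 0 -> p = 0.

(** The subfield k(u) of K.  It is a predicate on K and not a type, because fixed
    fields of several automorphisms have to be compared inside K. *)
Definition inRat u z := exists p q, ev u q != 0 /\ z = ev u p / ev u q.

Lemma inRat_ev u p : inRat u (ev u p).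
Proof. by exists p, 1; rewrite rmorph1 oner_eq0 divr1. Qed.

Lemma inRat_iota u c : inRat u (iota c).
Proof. by rewrite -(evC u); apply: inRat_ev. Qed.

Lemma inRat_id u : inRat u u.
Proof. by rewrite -{2}(evX u); apply: inRat_ev. Qed.

Lemma inRatB u z w : inRat u z -> inRat u w -> inRat u (z - w).
Proof.
move=> [p [q [q0 ->]]] [p' [q' [q'0 ->]]]; exists (p * q' - p' * q), (q * q').
rewrite !(rmorphB, rmorphM) /= mulf_neq0 //; split=> //.
by field; rewrite q0 q'0.
Qed.

Lemma inRat0 u : inRat u 0.
Proof. by rewrite -(rmorph0 iota); apply: inRat_iota. Qed.

Lemma inRat1 u : inRat u 1.
Proof. by rewrite -(rmorph1 iota); apply: inRat_iota. Qed.

Lemma inRatN u z : inRat u z -> inRat u (- z).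
Proof. by move=> h; rewrite -sub0r; apply: inRatB (inRat0 u) h. Qed.

Lemma inRatD u z w : inRat u z -> inRat u w -> inRat u (z + w).
Proof. by move=> hz /inRatN; rewrite -{2}(opprK w); apply: inRatB. Qed.

Lemma inRatM u z w : inRat u z -> inRat u w -> inRat u (z * w).
Proof.
move=> [p [q [q0 ->]]] [p' [q' [q'0 ->]]]; exists (p * p'), (q * q').
by rewrite !rmorphM /= mulf_neq0 // mulf_div.
Qed.

Lemma inRatV u z : inRat u z -> inRat u z^-1.
Proof.
move=> [p [q [q0 ->]]]; have [p0|p0] := eqVneq (ev u p) 0.
  by rewrite p0 mul0r invr0; apply: inRat0.
by exists q, p; rewrite p0 invf_div.
Qed.

Lemma inRat_div u z w : inRat u z -> inRat u w -> inRat u (z / w).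
Proof. by move=> hz /inRatV; apply: inRatM. Qed.

Lemma inRatX u z n : inRat u z -> inRat u (z ^+ n).
Proof.
move=> hz; elim: n => [|n IH]; first exact: inRat1.
by rewrite exprS; apply: inRatM.
Qed.

Lemma inRat_evw u w p : inRat u w -> inRat u (ev w p).
Proof.
move=> hw; elim/poly_ind: p => [|p c IH]; first by rewrite rmorph0; apply: inRat0.
rewrite rmorphD rmorphM /= evX evC; apply: inRatD (inRat_iota _ _).
exact: inRatM.
Qed.

Lemma inRat_trans u w z : inRat u w -> inRat w z -> inRat u z.
Proof. by move=> h [p [q [_ ->]]]; apply: inRat_div; apply: inRat_evw. Qed.

Lemma inRat_coprime u z : inRat u z ->
  exists p q, [/\ coprimep p q, ev u q != 0 & z = ev u p / ev u q].
Proof.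
move=> [p [q [q0 ->]]].
have qn0 : q != 0 by apply: contraNneq q0 => ->; rewrite rmorph0.
pose d := gcdp p q.
have [Ep Eq] : p = p %/ d * d /\ q = q %/ d * d.
  by split; rewrite divpK // ?dvdp_gcdl ?dvdp_gcdr.
have d0 : ev u d != 0.
  by apply: contraNneq q0 => d0; rewrite Eq rmorphM /= d0 mulr0.
have q1 : ev u (q %/ d) != 0.
  by apply: contraNneq q0 => q1; rewrite Eq rmorphM /= q1 mul0r.
exists (p %/ d), (q %/ d); split=> //.
  by apply: coprimep_div_gcd; rewrite qn0 orbT.
by rewrite {1}Ep {1}Eq !rmorphM /= -mulf_div divff // mulr1.
Qed.

Lemma transc_neq0 u p : transcendental u -> p != 0 -> ev u p != 0.
Proof. by move=> tu; apply: contraNneq => /tu ->. Qed.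

Lemma transc_inj u p q : transcendental u -> ev u p = ev u q -> p = q.
Proof.
move=> tu /eqP; rewrite -subr_eq0 -rmorphB => /eqP /tu /eqP.
by rewrite subr_eq0 => /eqP.
Qed.

(** A polynomial splits over k, so one of its linear factors vanishes at u. *)
Lemma algebraic_const u p : p != 0 -> ev u p = 0 -> exists c, u = iota c.
Proof.
elim: {p}(size p) {-2}p (leqnn (size p)) => [|n IH] p sp p0 pu0.
  by move: p0; rewrite -size_poly_eq0 -leqn0 sp.
have [sp1|sp1] := eqVneq (size p) 1%N.
  have /eqP/size_poly1P[c c0 Ep] := sp1.
  by move: pu0 c0; rewrite Ep evC => /eqP; rewrite fmorph_eq0 => ->.
have [a /factor_theorem[q Ep]] := closed_rootP p sp1.
move: pu0; rewrite Ep rmorphM rmorphB /= evX evC => /eqP.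
rewrite mulf_eq0 subr_eq0 => /orP[/eqP q0|/eqP ->]; last by exists a.
have qn0 : q != 0 by apply: contraNneq p0 => q_0; rewrite Ep q_0 mul0r.
apply: (IH q) => //; move: sp.
by rewrite Ep size_mul ?polyXsubC_eq0 // size_XsubC addn2.
Qed.

(** An element w that is algebraic over k is a constant, and so are then the elements
    of k(w). *)
Lemma transc_of_inRat u w : transcendental u -> inRat w u -> transcendental w.
Proof.
move=> tu uw p pw0; apply/eqP; apply: contraT => p0.
have [c Ew] := algebraic_const p0 pw0.
have [r [s [_ Eu]]] := uw.
have E : u = iota (r.[c] / s.[c]).
  by rewrite Eu Ew !evE !horner_map fmorph_div.
have /tu/eqP : ev u ('X - (r.[c] / s.[c])%:P) = 0.
  by rewrite rmorphB /= evX evC {1}E subrr.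
by rewrite polyXsubC_eq0.
Qed.

Lemma transc_const u c : transcendental u -> u <> iota c.
Proof.
move=> tu E; have /tu/eqP : ev u ('X - c%:P) = 0.
  by rewrite rmorphB /= evX evC E subrr.
by rewrite polyXsubC_eq0.
Qed.

Lemma avoid_seq (L : seq k) : exists c, c \notin L.
Proof.
have : \prod_(a <- L) ('X - a%:P) != 0.
  by rewrite monic_neq0 // monic_prod_XsubC.
by case/closed_nonrootP=> c; rewrite root_prod_XsubC => h; exists c.
Qed.

End RationalFunctions.

(** * Moebius transformations *)

Section Homogenization.

Variable k : fieldType.

(** The value at (x, y) of the binary form y^m A(x / y) of degree m; roots at infinity
    make up for a degree of A below m. *)
Definition form_value (R : comAlgType k) (m : nat) (A : {poly k}) (x y : R) : R :=
  \sum_(i < m.+1) A`_i *: (x ^+ i * y ^+ (m - i)).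

Lemma form_value_morph (L : fieldType) (iota : {rmorphism k -> L})
    (f : {rmorphism {poly k} -> L}) (fC : forall c, f c%:P = iota c)
    (m : nat) (A p q : {poly k}) :
  (size A <= m.+1)%N -> f q != 0 ->
  f (form_value m A p q) = f q ^+ m * (map_poly iota A).[f p / f q].
Proof.
move=> sA q0; rewrite rmorph_sum /= (@horner_coef_wide _ m.+1).
  rewrite mulr_sumr; apply: eq_bigr => i _.
  rewrite -mul_polyC !rmorphM /= fC !rmorphXn /= coef_map /=.
  have -> : f q ^+ m = f q ^+ (m - i) * f q ^+ i by rewrite -exprD subnK -1?ltnS.
  by rewrite expr_div_n; field; rewrite expf_neq0.
by rewrite size_map_poly.
Qed.

Lemma horner_form_value (m : nat) (A p q : {poly k}) (a : k) :
  (size A <= m.+1)%N -> q.[a] != 0 ->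
  (form_value m A p q).[a] = q.[a] ^+ m * A.[p.[a] / q.[a]].
Proof.
move=> sA q0; have fC c : horner_eval a c%:P = idfun c by apply: hornerC.
by have := form_value_morph fC p sA q0; rewrite map_poly_id.
Qed.

End Homogenization.

Lemma ev_form_value (k : closedFieldType) (K : fieldType)
    (iota : {rmorphism k -> K}) (u : K) (m : nat) (A p q : {poly k}) :
  (size A <= m.+1)%N -> ev iota u q != 0 ->
  ev iota u (form_value m A p q) =
    ev iota u q ^+ m * ev iota (ev iota u p / ev iota u q) A.
Proof. exact: (form_value_morph (f := ev iota u) (evC iota u)). Qed.

Lemma size_lin (R : nzRingType) (a b : R) : (size (a *: 'X + b%:P)%R <= 2)%N.
Proof.
apply: leq_trans (size_polyD _ _) _; rewrite geq_max.
rewrite (leq_trans (size_scale_leq _ _)) ?size_polyX //.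
by rewrite (leq_trans (size_polyC_leq1 _)).
Qed.

Lemma poly_size2 (R : nzRingType) (p : {poly R}) :
  (size p <= 2)%N -> p = p`_1 *: 'X + (p`_0)%:P.
Proof.
move=> sp; apply/polyP=> -[|[|i]];
  rewrite coefD coefZ coefX coefC ?mulr0 ?mulr1 ?add0r ?addr0 //=.
by rewrite nth_default // (leq_trans sp).
Qed.

Lemma size_form_value (k : fieldType) (m : nat) (A p q : {poly k}) :
  (size p <= 2)%N -> (size q <= 2)%N -> (size (form_value m A p q) <= m.+1)%N.
Proof.
have lin_pow (r : {poly k}) n : (size r <= 2 -> size (r ^+ n) <= n.+1)%N.
  move=> sr; apply: leq_trans (size_poly_exp_leq _ _) _; rewrite ltnS.
  by rewrite -[X in (_ <= X)%N]mul1n leq_mul2r;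
    case: (size r) sr => [|[|[]]] //; rewrite orbT.
move=> sp sq; apply: leq_trans (size_sum _ _ _) _; apply/bigmax_leqP=> i _.
apply: leq_trans (size_scale_leq _ _) _.
apply: leq_trans (size_polyMleq _ _) _.
have := leq_add (lin_pow p i sp) (lin_pow q (m - i)%N sq).
by rewrite addSn addnS subnKC -1?ltnS // => h; rewrite -ltnS; case: (_ + _)%N h.
Qed.

Lemma char0_natf (k : fieldType) : [pchar k] =i pred0 ->
  forall n, (n.+1)%:R != 0 :> k.
Proof. by move=> h n; move: h => /pcharf0P->. Qed.

Section Moebius.

Variables (k : closedFieldType) (K : fieldType) (iota : {rmorphism k -> K}).
Hypothesis char0 : [pchar k] =i pred0.
Implicit Types (u v w z : K) (p q : {poly k}).
Local Notation ev := (ev iota).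
Local Notation inRat := (inRat iota).
Local Notation transcendental := (transcendental iota).

Lemma deriv_eq0 p : p^`() = 0 -> (size p <= 1)%N.
Proof.
move=> dp0; apply/leq_sizeP=> -[|i] // _.
have := coef_deriv p i; rewrite dp0 coef0 => /esym/eqP.
by rewrite -mulr_natr mulf_eq0 (negPf (char0_natf char0 i)) orbF => /eqP.
Qed.

(** If p' q = p q' with p and q coprime, then p divides p', so that p' = 0. *)
Lemma wronskian_neq0 p q : coprimep p q -> q != 0 -> (1 < size p)%N ->
  p^`() * q - p * q^`() != 0.
Proof.
move=> cpq q0 sp; apply/negP; rewrite subr_eq0 => /eqP E.
have : p %| p^`().
  by rewrite -(Gauss_dvdpl _ cpq) E dvdp_mulr.
have [/deriv_eq0|d0] := eqVneq p^`() 0; first by rewrite leqNgt sp.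
move/(dvdp_leq d0); rewrite leqNgt lt_size_deriv //.
by apply: contraTneq sp => ->; rewrite size_poly0.
Qed.

(** A rational function p/q that generates k(u) is a bijection of the projective
    line: if u = A(w)/B(w) then a root of p - c q can only be A(c)/B(c).  A
    multiple root would be a zero of the Wronskian of p and q, so for all but
    finitely many c the polynomial p - c q has degree at most one. *)
Lemma moebius_of_mutual u w : transcendental u -> inRat u w -> inRat w u ->
  exists a b c d : k, [/\ a * d - b * c != 0, ev u (c *: 'X + d%:P) != 0
    & w = ev u (a *: 'X + b%:P) / ev u (c *: 'X + d%:P)].
Proof.
move=> tu uw wu.
have tw : transcendental w := transc_of_inRat tu wu.
have [p [q [cpq qu0 Ew]]] := inRat_coprime uw.
have [A [B [Bw0 Eu]]] := wu.
have q0 : q != 0 by apply: contraNneq qu0 => ->; rewrite rmorph0.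
have B0 : B != 0 by apply: contraNneq Bw0 => ->; rewrite rmorph0.
have wc c : w <> iota c by apply: transc_const.
have sp : (1 < size p)%N || (1 < size q)%N.
  apply: contraT; rewrite negb_or -!leqNgt => /andP[/size1_polyC Ep /size1_polyC Eq].
  case: (wc (p`_0 / q`_0)); rewrite Ew Ep Eq !evC fmorph_div !coefC //.
pose W := p^`() * q - p * q^`().
have W0 : W != 0.
  case/orP: sp => [sp|sq]; first exact: wronskian_neq0.
  have [p0|p0] := eqVneq p 0.
    by case: (wc 0); rewrite Ew p0 !rmorph0 mul0r.
  rewrite -oppr_eq0 opprB [p * _]mulrC [_ * q]mulrC.
  by rewrite wronskian_neq0 // coprimep_sym.
pose m := maxn (size A) (size B).
have sAm : (size A <= m.+1)%N by rewrite leqW // leq_maxl.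
have sBm : (size B <= m.+1)%N by rewrite leqW // leq_maxr.
(* This is u B(w) = A(w) with denominators cleared. *)
have id_poly : 'X * form_value m B p q = form_value m A p q.
  apply: (transc_inj tu); rewrite rmorphM /= evX.
  rewrite !ev_form_value // -Ew.
  by rewrite {1}Eu mulrCA divfK.
have root_val c a : B.[c] != 0 -> root (p - c *: q) a -> a = A.[c] / B.[c].
  move=> Bc; rewrite /root !hornerE subr_eq0 => /eqP pa.
  have qa : q.[a] != 0.
    apply/negP=> qa; have := coprimep_root cpq.
    by move/(_ a); rewrite /root pa (eqP qa) mulr0 eqxx => /(_ isT)/negP.
  have := congr1 (fun f => f.[a]) id_poly.
  rewrite hornerM hornerX !horner_form_value // pa mulfK //.
  rewrite mulrCA => /(mulfI (expf_neq0 _ qa)) <-.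
  by rewrite mulfK.
have good : exists L : seq k, forall c, c \notin L ->
    B.[c] != 0 /\ (size (p - c *: q)%R <= 2)%N.
  have [sB EB] := closed_field_poly_normal B.
  have [sW EW] := closed_field_poly_normal W.
  exists (sB ++ [seq p.[a] / q.[a] | a <- sW]) => c.
  rewrite mem_cat negb_or => /andP[cB cW].
  have Bc : B.[c] != 0.
    move: cB; rewrite -root_prod_XsubC; apply: contra => /eqP Bc.
    by move: Bc; rewrite {1}EB hornerZ => /eqP; rewrite mulf_eq0 lead_coef_eq0 (negPf B0).
  split=> //; rewrite leqNgt; apply/negP=> sf.
  set f := p - c *: q in sf *.
  have [a ra] : exists a, root f a by apply/closed_rootP; rewrite gtn_eqF // ltnW.
  have [g Ef] := factor_theorem _ _ ra.
  have g0 : g != 0.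
    by apply: contraTneq sf => g0; rewrite Ef g0 mul0r size_poly0.
  have [a' ra'] : exists a', root g a'.
    apply/closed_rootP; move: sf; rewrite Ef size_mul ?polyXsubC_eq0 //.
    by rewrite size_XsubC addn2 /=; case: (size g) => [|[|]].
  have Ea : a' = a.
    have rfa' : root f a'.
      by move: ra'; rewrite /root Ef hornerM => /eqP->; rewrite mul0r.
    by rewrite (root_val c a' Bc rfa') -(root_val c a Bc ra).
  have df : f^`().[a] = 0.
    rewrite Ef derivM derivXsubC !hornerE subrr mulr0 add0r.
    by rewrite -Ea; apply/eqP.
  have pa : p.[a] = c * q.[a].
    by move: ra; rewrite /root !hornerE subr_eq0 => /eqP.
  have qa : q.[a] != 0.
    apply/negP=> qa; have := coprimep_root cpq.
    by move/(_ a); rewrite /root pa (eqP qa) mulr0 eqxx => /(_ isT)/negP.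
  have Wa : W.[a] = 0.
    rewrite /W !hornerE pa; move: df; rewrite /f derivB derivZ !hornerE.
    by move/eqP; rewrite subr_eq0 => /eqP->; ring.
  move: cW; apply/negP; rewrite negbK; apply/mapP; exists a; last by rewrite pa mulfK.
  move: Wa; rewrite {1}EW hornerZ => /eqP; rewrite mulf_eq0 lead_coef_eq0 (negPf W0) /=.
  by rewrite -/(root _ _) root_prod_XsubC.
have [L hL] := good.
have [c1 c1L] := avoid_seq L; have [c2 ] := avoid_seq (c1 :: L).
rewrite inE negb_or => /andP[c12 c2L].
have [_ s1] := hL _ c1L; have [_ s2] := hL _ c2L.
have c12' : c1 - c2 != 0 by rewrite subr_eq0 eq_sym.
have sq : (size q <= 2)%N.
  have -> : q = (c1 - c2)^-1 *: ((p - c2 *: q) - (p - c1 *: q)).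
    have -> : (p - c2 *: q) - (p - c1 *: q) = c1 *: q - c2 *: q.
      by rewrite opprB [LHS]addrC addrA subrK.
    by rewrite -scalerBl scalerA mulVf ?scale1r.
  rewrite (leq_trans (size_scale_leq _ _)) // (leq_trans (size_polyD _ _)) //.
  by rewrite size_polyN geq_max s1 s2.
have sp2 : (size p <= 2)%N.
  have -> : p = (p - c1 *: q) + c1 *: q by rewrite -addrA addNr addr0.
  rewrite (leq_trans (size_polyD _ _)) // geq_max s1.
  by rewrite (leq_trans (size_scale_leq _ _)).
(* If the determinant vanished, w would be a constant. *)
exists p`_1, p`_0, q`_1, q`_0.
rewrite -!poly_size2 //; split=> //.
apply/negP; rewrite subr_eq0 => /eqP det0.
have E1 : p`_1 *: q = q`_1 *: p.
  rewrite {2}(poly_size2 sp2) {1}(poly_size2 sq) !scalerDr !scalerA mulrC.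
  by rewrite -!mul_polyC -!polyCM det0 [q`_1 * p`_0]mulrC.
have [q10|q10] := eqVneq q`_1 0; last first.
  apply: (wc (p`_1 / q`_1)); rewrite Ew fmorph_div; apply/eqP.
  rewrite eqr_div ?fmorph_eq0 // mulrC -!evZ E1 //.
have p10 : p`_1 = 0.
  move: E1; rewrite q10 scale0r => /eqP.
  by rewrite -mul_polyC mulf_eq0 (negPf q0) orbF polyC_eq0 => /eqP.
apply: (wc (p`_0 / q`_0)); rewrite Ew (poly_size2 sp2) (poly_size2 sq) p10 q10.
by rewrite !scale0r !add0r !evC fmorph_div !coefC.
Qed.

End Moebius.

(** * Uniqueness of the hyperelliptic involution *)

Section HyperellipticInvolution.

Variables (k : closedFieldType) (K : fieldType) (iota : {rmorphism k -> K}).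
Hypothesis char0 : [pchar k] =i pred0.
Implicit Types (u v w x z : K) (p q : {poly k}) (s t : {rmorphism K -> K}).
Local Notation ev := (ev iota).
Local Notation inRat := (inRat iota).
Local Notation transcendental := (transcendental iota).

Definition sameRat u w := inRat u w /\ inRat w u.

Lemma sameRat_trans u w x : sameRat u w -> sameRat w x -> sameRat u x.
Proof.
move=> [uw wu] [wx xw]; split; [exact: inRat_trans wx | exact: inRat_trans wu].
Qed.

Lemma transc_same u w : transcendental u -> sameRat u w -> transcendental w.
Proof. by move=> tu [_ wu]; apply: transc_of_inRat wu. Qed.

Lemma transc_n0 u : transcendental u -> u != 0.
Proof. by move=> tu; rewrite -(evX iota u) transc_neq0 ?polyX_eq0. Qed.

Definition fixes_constants s := forall a, s (iota a) = iota a.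

Lemma ev_morph s u p : fixes_constants s -> s (ev u p) = ev (s u) p.
Proof.
move=> sk; rewrite /ev /= /horner_eval -horner_map /= -map_poly_comp /=.
by congr _.[_]; apply: eq_map_poly => a; apply: sk.
Qed.

Lemma inRat_morph s u z : fixes_constants s -> inRat u z -> inRat (s u) (s z).
Proof.
move=> sk [p [q [q0 ->]]]; exists p, q.
by rewrite -!ev_morph // fmorph_eq0 fmorph_div.
Qed.

Lemma inRat_fix s u z : fixes_constants s -> s u = u -> inRat u z -> s z = z.
Proof.
by move=> sk su [p [q [q0 ->]]]; rewrite fmorph_div !ev_morph // su.
Qed.

Lemma inRat_iter s u z n : fixes_constants s -> iter n s u = u -> inRat u z ->
  iter n s z = z.
Proof.
move=> sk su [p [q [q0 ->]]].
have iter_ev r : iter n s (ev u r) = ev (iter n s u) r.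
  by elim: n {su} => //= n ->; rewrite ev_morph.
have -> : iter n s (ev u p / ev u q) = iter n s (ev u p) / iter n s (ev u q).
  by elim: n {su iter_ev} => //= n ->; rewrite fmorph_div.
by rewrite !iter_ev su.
Qed.

Let two_neq0 : 2%:R != 0 :> K.
Proof. by rewrite -(rmorph_nat iota) fmorph_eq0 char0_natf. Qed.

(** An affine map that is not a translation has a fixed point, to be taken as origin;
    a translation of finite order is trivial in characteristic zero. *)
Lemma affine_linearize s w n (a b : k) : fixes_constants s -> (0 < n)%N ->
    iter n s w = w -> s w = iota a * w + iota b ->
  exists x c, sameRat w x /\ s x = iota c * x.
Proof.
move=> sk n0 snw sw; have [a1|a1] := eqVneq a 1; last first.
  exists (w + iota (b / (a - 1))), a; split.
    have kc c := inRat_iota iota w c.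
    split; first exact: inRatD (inRat_id _ _) (kc _).
    rewrite -{2}(addrK (iota (b / (a - 1))) w).
    by apply: inRatB; [apply: inRat_id | apply: inRat_iota].
  rewrite rmorphD /= sw sk mulrDr -addrA -rmorphD -rmorphM /=.
  by congr (_ + _); apply: (congr1 iota); field; rewrite subr_eq0.
exists w, 1; split; first by split; apply: inRat_id.
have E j : iter j s w = w + iota b *+ j.
  elim: j => [|j IH]; first by rewrite addr0.
  by rewrite /= IH rmorphD rmorphMn /= sk sw a1 rmorph1 mul1r -addrA mulrS.
move: snw; rewrite E => /eqP; rewrite -subr_eq0 addrAC subrr add0r -mulr_natr.
rewrite mulf_eq0 -(rmorph_nat iota) !fmorph_eq0.
case: n n0 {E} => // n _; rewrite (negPf (char0_natf char0 n)) orbF => /eqP b0.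
by rewrite sw b0 a1 rmorph0 addr0.
Qed.

(** A Moebius transformation fixes a point; moving that point to infinity makes the
    transformation affine. *)
Lemma linearize s u n : transcendental u -> fixes_constants s -> (0 < n)%N ->
    iter n s u = u -> sameRat u (s u) ->
  exists w c, sameRat u w /\ s w = iota c * w.
Proof.
move=> tu sk n0 snu [usu suu].
have [a [b [c [d [det0 cd0 Esu]]]]] := moebius_of_mutual char0 tu usu suu.
have evL e f : ev u (e *: 'X + f%:P) = iota e * u + iota f.
  by rewrite rmorphD /= evZ evX evC.
rewrite !evL in cd0 Esu.
have [c0|c0] := eqVneq c 0.
  move: det0 cd0 Esu; rewrite c0 mulr0 subr0 rmorph0 mul0r add0r.
  rewrite mulf_eq0 negb_or fmorph_eq0 => /andP[_ _] d0 Esu.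
  apply: (affine_linearize (a := a / d) (b := b / d) sk n0 snu).
  by rewrite Esu !fmorph_div; field; rewrite fmorph_eq0.
(* e is a fixed point of the transformation. *)
have [e Ee] : exists e, c * e ^+ 2 + d * e = a * e + b.
  have [e] := @solve_monicpoly k 2 (fun i => if i == 0%N then b / c else (a - d) / c) isT.
  rewrite !big_ord_recl big_ord0 /= => Ee; exists e; rewrite Ee; field.
  exact: c0.
have ace : a - e * c != 0.
  apply: contra det0 => /eqP ace; have Ea : a = e * c by apply/eqP; rewrite -subr_eq0 ace.
  move: Ee; rewrite Ea => /eqP; rewrite -subr_eq0 => /eqP h.
  by apply/eqP; rewrite -(mulr0 c) -h; ring.
have ue : u - iota e != 0.
  by apply/negP; rewrite subr_eq0 => /eqP; apply: transc_const.
pose w := (u - iota e)^-1.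
have uw : sameRat u w.
  split; first by apply/inRatV/inRatB; [apply: inRat_id | apply: inRat_iota].
  have -> : u = w^-1 + iota e by rewrite invrK subrK.
  by apply: inRatD (inRat_iota _ _ _); apply/inRatV/inRat_id.
have Esw : s w = iota ((c * e + d) / (a - e * c)) * w + iota (c / (a - e * c)).
  have Eb : iota b = iota c * iota e ^+ 2 + iota d * iota e - iota a * iota e.
    rewrite -rmorphXn -!rmorphM -rmorphD -rmorphB /=.
    by rewrite Ee addrC addKr.
  have ace' : iota a - iota e * iota c != 0 by rewrite -rmorphM -rmorphB fmorph_eq0.
  have sE : s u - iota e =
      (iota a - iota e * iota c) * (u - iota e) / (iota c * u + iota d).
    by rewrite Esu Eb; field.
  rewrite fmorphV rmorphB /= sk sE !fmorph_div !(rmorphB, rmorphD, rmorphM) /= /w.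
  by field; rewrite ue cd0 ace'.
have snw := inRat_iter sk snu uw.1.
have [x [f [wx sx]]] := affine_linearize sk n0 snw Esw.
by exists x, f; split=> //; apply: sameRat_trans wx.
Qed.

(** When K is quadratic over k(u), this says that its genus is at least three: a curve
    of genus at most two has an equation z^2 = N(u) of degree at most six.  In this
    form the condition depends on the subfield k(u) and not on an equation. *)
Definition high_genus u := forall z (N : {poly k}),
  ~ inRat u z -> z ^+ 2 = ev u N -> (7 < size N)%N.

(** For w = P(u) / Q(u) with P and Q of degree one, multiplying z by Q(u)^3 turns an
    equation z^2 = N(w) of degree at most six into one in u. *)
Lemma high_genus_same u w : transcendental u -> sameRat u w -> high_genus u -> high_genus w.
Proof.
move=> tu [uw wu] hu z N nz Ez; rewrite ltnNge; apply/negP=> sN.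
have [a [b [c [d [_ Q0 Ew]]]]] := moebius_of_mutual char0 tu uw wu.
set Q := c *: 'X + d%:P in Q0 Ew; set P := a *: 'X + b%:P in Ew.
suff : (7 < size (form_value 6 N P Q))%N by rewrite ltnNge size_form_value ?size_lin.
apply: (hu (z * ev u Q ^+ 3)).
  move=> h; apply: nz; apply: inRat_trans wu _.
  rewrite -(mulfK (expf_neq0 3 Q0) z).
  by apply: inRat_div h _; apply: inRatX; apply: inRat_ev.
by rewrite ev_form_value // -Ew -Ez; ring.
Qed.

(** Data of a hyperelliptic involution s in genus at least three: its fixed field is a
    rational field k(u), and v witnesses that it is not the identity. *)
Record hyp_inv s u v : Prop := HypInv {
  hyp_transc : transcendental u;
  hyp_k : fixes_constants s;
  hyp_invol : forall z, s (s z) = z;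
  hyp_fix : forall z, s z = z <-> inRat u z;
  hyp_anti : s v = - v;
  hyp_v0 : v != 0;
  hyp_genus : high_genus u }.

Lemma hyp_decomp s u v z : hyp_inv s u v ->
  exists a b, [/\ inRat u a, inRat u b & z = a + b * v].
Proof.
move=> H; exists ((z + s z) / 2%:R), ((z - s z) / (2%:R * v)); split.
- apply/(hyp_fix H); rewrite fmorph_div rmorphD /= (hyp_invol H) rmorph_nat.
  by rewrite addrC.
- apply/(hyp_fix H); rewrite fmorph_div rmorphB rmorphM /= (hyp_invol H) rmorph_nat.
  by rewrite (hyp_anti H); field; rewrite oppr_eq0 (hyp_v0 H) two_neq0.
- move: (hyp_v0 H) => v0; move: (s z) => y.
  by field; rewrite v0 two_neq0.
Qed.

Lemma anti_neq v : v != 0 -> v <> - v.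
Proof.
move=> v0 /eqP; rewrite -subr_eq0 opprK -mulr2n -mulr_natr mulf_eq0.
by rewrite (negPf v0) (negPf two_neq0).
Qed.

(** If s' is trivial on k(u), it acts on v by a sign, and it is not the identity. *)
Lemma hyp_inv_eq_of_fix s u v s' u' v' : hyp_inv s u v -> hyp_inv s' u' v' ->
  s' u = u -> s =1 s'.
Proof.
move=> H H' s'u.
have s'k := hyp_k H'.
have fix' z : inRat u z -> s' z = z by apply: inRat_fix.
have Ev2 : s' (v ^+ 2) = v ^+ 2.
  by apply: fix'; apply/(hyp_fix H); rewrite rmorphXn /= (hyp_anti H) sqrrN.
have /eqP := Ev2; rewrite rmorphXn /= eqf_sqr => /orP[]/eqP s'v.
  have s'1 z : s' z = z.
    have [a [b [ua ub ->]]] := hyp_decomp z H.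
    by rewrite rmorphD rmorphM /= s'v !fix'.
  case: (anti_neq (hyp_v0 H')); by rewrite -(hyp_anti H') s'1.
move=> z; have [a [b [ua ub ->]]] := hyp_decomp z H.
rewrite !(rmorphD, rmorphM) /= s'v (hyp_anti H) !fix' //.
by rewrite !(iffRL (hyp_fix H _)).
Qed.

(** In a coordinate w that diagonalizes it, an involution acts by w |-> - w. *)
Lemma hyp_anti_coord s u v t : hyp_inv s u v -> fixes_constants t ->
    (forall z, t (t z) = z) -> (forall z, s (t z) = t (s z)) -> t u <> u ->
  exists w, sameRat u w /\ t w = - w.
Proof.
move=> H tk tt st tu.
have su : s u = u by apply/(hyp_fix H)/inRat_id.
have utu : inRat u (t u) by apply/(hyp_fix H); rewrite st su.
have tuu : inRat (t u) u by rewrite -{2}(tt u); apply: inRat_morph.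
have [w [c [uw tw]]] := linearize (n := 2) (hyp_transc H) tk isT (tt u) (conj utu tuu).
exists w; split=> //; have w0 := transc_n0 (transc_same (hyp_transc H) uw).
have /eqP := tt w; rewrite tw rmorphM /= tk tw mulrA -subr_eq0 -{2}[w]mul1r.
rewrite -mulrBl mulf_eq0 (negPf w0) orbF subr_eq0 -expr2 -(expr1n _ 2) eqf_sqr.
case/orP=> /eqP Ec; last by rewrite Ec mulN1r.
case: tu; apply: inRat_fix uw.2 => //; by rewrite tw Ec mul1r.
Qed.

(** An even rational function p(x) / q(x) is a rational function of x^2: multiplied by
    q(-x), both its numerator and its denominator become even polynomials. *)
Lemma inRat_sqr s x z : transcendental x -> fixes_constants s -> s x = - x -> inRat x z ->
  s z = z -> inRat (x ^+ 2) z.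
Proof.
move=> tx sk sx [p [q [q0 Ez]]] sz.
have even_inRat r : s (ev x r) = ev x r -> inRat (x ^+ 2) (ev x r).
  have x20 : s (x ^+ 2) = x ^+ 2 by rewrite rmorphXn /= sx sqrrN.
  have Er : ev x r = ev (x ^+ 2) (even_poly r) + ev (x ^+ 2) (odd_poly r) * x.
    by rewrite -{1}[r]poly_even_odd !(rmorphD, rmorphM) /= !ev_comp !rmorphXn /= !evX.
  rewrite Er rmorphD rmorphM /= !ev_morph // x20 sx mulrN => /addrI/esym odd0.
  have -> : ev (x ^+ 2) (odd_poly r) * x = 0.
    by apply/eqP; apply: contraT => /anti_neq/(_ odd0).
  by rewrite addr0; apply: inRat_ev.
have tq0 : s (ev x q) != 0 by rewrite fmorph_eq0.
have -> : z = ev x (p * (q \Po - 'X)) / ev x (q * (q \Po - 'X)).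
  rewrite Ez !rmorphM /= ev_comp rmorphN /= evX -sx -ev_morph //.
  by field; rewrite q0 tq0.
have Esq : ev x (q \Po - 'X) = s (ev x q).
  by rewrite ev_morph // sx ev_comp rmorphN /= evX.
have s2 : s (s (ev x q)) = ev x q.
  by rewrite !ev_morph // sx rmorphN /= sx opprK.
have sden : s (ev x (q * (q \Po - 'X))) = ev x (q * (q \Po - 'X)).
  by rewrite rmorphM /= Esq rmorphM /= s2 mulrC.
apply: inRat_div; apply: even_inRat => //.
have -> : ev x (p * (q \Po - 'X)) = z * ev x (q * (q \Po - 'X)).
  by rewrite Ez !rmorphM /= Esq; field.
by rewrite rmorphM /= sz sden.
Qed.

(** Two distinct commuting involutions s and s' act by sign changes on suitable
    generators w of the fixed field of s and x of that of s'.  The field fixed by both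
    is k(w^2) as well as k(x^2), so x^2 is a Moebius function of w^2.  Clearing its
    denominator gives an element outside k(w) whose square is a polynomial of degree
    at most four in w, against the genus. *)
Lemma hyp_inv_unique_comm s u v s' u' v' : hyp_inv s u v -> hyp_inv s' u' v' ->
  (forall z, s (s' z) = s' (s z)) -> s =1 s'.
Proof.
move=> H H' comm.
have [su'|su'] := eqVneq (s u') u'; first by move=> z; rewrite (hyp_inv_eq_of_fix H' H su').
have [s'u|s'u] := eqVneq (s' u) u; first exact: hyp_inv_eq_of_fix H H' s'u.
have [w [uw s'w]] := hyp_anti_coord H (hyp_k H') (hyp_invol H') comm (elimN eqP s'u).
have [x [ux sx]] :=
  hyp_anti_coord H' (hyp_k H) (hyp_invol H) (fun z => esym (comm z)) (elimN eqP su').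
have tw := transc_same (hyp_transc H) uw.
have tx := transc_same (hyp_transc H') ux.
have sw : s w = w by apply/(hyp_fix H); case: uw.
have s'x : s' x = x by apply/(hyp_fix H'); case: ux.
have hw := high_genus_same (hyp_transc H) uw (hyp_genus H).
have xw : inRat (x ^+ 2) (w ^+ 2).
  apply: (inRat_sqr tx (hyp_k H) sx); last by rewrite rmorphXn /= sw.
  apply: inRat_trans ux.2 _; apply/(hyp_fix H').
  by rewrite rmorphXn /= s'w sqrrN.
have wx : inRat (w ^+ 2) (x ^+ 2).
  apply: (inRat_sqr tw (hyp_k H') s'w); last by rewrite rmorphXn /= s'x.
  apply: inRat_trans uw.2 _; apply/(hyp_fix H).
  by rewrite rmorphXn /= sx sqrrN.
have tw2 : transcendental (w ^+ 2).
  move=> p pw; apply/eqP; apply: contraT => /algebraic_const/(_ pw)[c Ec].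
  have /tw/eqP : ev w ('X^2 - c%:P) = 0.
    by rewrite rmorphB rmorphXn /= evX evC Ec subrr.
  by rewrite -size_poly_eq0 size_XnsubC.
have [a [b [c [d [_ Q0 Ex]]]]] := moebius_of_mutual char0 tw2 wx xw.
pose y := x * ev (w ^+ 2) (c *: 'X + d%:P).
have evw e f : ev (w ^+ 2) (e *: 'X + f%:P) = ev w (e *: 'X^2 + f%:P).
  by rewrite !rmorphD /= !evZ !evC rmorphXn /= !evX.
have sy : s y = - y.
  by rewrite /y rmorphM /= sx evw ev_morph ?sw ?mulNr //; apply: hyp_k H.
have y0 : y != 0 by rewrite mulf_neq0 // transc_n0.
suff : (7 < size ((a *: 'X^2 + b%:P) * (c *: 'X^2 + d%:P))%R)%N.
  have s3 e f : (size (e *: 'X^2 + f%:P : {poly k})%R <= 3)%N.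
    rewrite (leq_trans (size_polyD _ _)) // geq_max.
    rewrite (leq_trans (size_scale_leq _ _)) ?size_polyXn //=.
    by rewrite (leq_trans (size_polyC_leq1 _)).
  rewrite ltnNge (leq_trans (size_polyMleq _ _)) //.
  have := leq_add (s3 a b) (s3 c d).
  by case: (_ + _)%N => //= n; rewrite ltnS => /leqW/leqW.
apply: (hw y).
  move=> wy; apply: (anti_neq y0); rewrite -sy; apply/esym/(hyp_fix H).
  exact: inRat_trans uw.1 wy.
by rewrite rmorphM /= -!evw exprMn Ex expr2 mulrA (divfK Q0).
Qed.

Lemma hyp_inv_conj s u v (t t' : {rmorphism K -> K}) : hyp_inv s u v -> fixes_constants t ->
    cancel t t' -> cancel t' t ->
  hyp_inv (t \o s \o t') (t u) (t v).
Proof.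
move=> H tk tK t'K.
have t'k : fixes_constants t' by move=> a; rewrite -(tk a) tK.
have [tu sk ss sf sv v0 hg] := H.
have conv z : inRat (t u) z <-> inRat u (t' z).
  split=> [/(inRat_morph t'k)|/(inRat_morph tk)]; first by rewrite tK.
  by rewrite t'K.
split=> //=.
- move=> p; rewrite -ev_morph // => /eqP; rewrite fmorph_eq0 => /eqP; exact: tu.
- by move=> a; rewrite /= t'k sk tk.
- by move=> z; rewrite tK ss t'K.
- move=> z; split=> [E|/conv/sf E]; last by rewrite E t'K.
  by apply/conv/sf; rewrite -[LHS]tK E.
- by rewrite tK sv rmorphN.
- by rewrite fmorph_eq0.
move=> z N nz Ez; apply: (hg (t' z)); first by move/conv.
by rewrite -rmorphXn Ez ev_morph // tK.
Qed.

(** If (s s')^4 = 1, then s commutes with its conjugate by s'.  The commuting case shows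
    that s equals this conjugate, so s commutes with s' and the commuting case applies
    again. *)
Lemma hyp_inv_unique s u v s' u' v' : hyp_inv s u v -> hyp_inv s' u' v' ->
  (forall z, iter 4 (s \o s') z = z) -> s =1 s'.
Proof.
move=> H H' ord4.
have s'K := hyp_invol H'; have sK := hyp_invol H.
have H2 : hyp_inv (s' \o s \o s') (s' u) (s' v).
  exact: (hyp_inv_conj H (hyp_k H') s'K s'K).
have E : s =1 s' \o s \o s'.
  apply: (hyp_inv_unique_comm H H2) => z /=.
  by have := ord4 (s' (s (s' (s z)))); rewrite /= !(s'K, sK).
apply: (hyp_inv_unique_comm H H') => z.
by rewrite [LHS]E /= s'K.
Qed.

End HyperellipticInvolution.

(** * Models Y^2 = F(X) *)

Section PlaneModels.

Variables (k : closedFieldType) (K : fieldType) (iota : {rmorphism k -> K}).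
Implicit Types (u v w x y z : K) (p q F : {poly k}) (P Q : {poly {poly k}}).
Local Notation ev := (ev iota).
Local Notation inRat := (inRat iota).
Local Notation transcendental := (transcendental iota).

Definition ev2 u v : {poly {poly k}} -> K :=
  horner_eval v \o horner_eval u%:P \o map_poly (map_poly iota).

HB.instance Definition _ u v := GRing.RMorphism.on (ev2 u v).

Lemma eval_atE P u v : eval_at iota P u v = ev2 u v P.
Proof. by []. Qed.

Lemma ev2_X u v : ev2 u v 'X = u.
Proof. by rewrite /ev2 /= /horner_eval map_polyX hornerX hornerC. Qed.

Lemma ev2_C u v p : ev2 u v p%:P = ev v p.
Proof. by rewrite /ev2 /= /horner_eval map_polyC hornerC. Qed.

Lemma ev2_polyC u v p : ev2 u v p^:P = ev u p.
Proof.
elim/poly_ind: p => [|p c IH]; first by rewrite map_poly0 !rmorph0.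
rewrite !(rmorphD, rmorphM) /= map_polyX ev2_X IH map_polyC /= ev2_C.
by rewrite !evC evX.
Qed.

Lemma ev2_eqn u v F : ev2 u v (hyperelliptic_eqn F) = v ^+ 2 - ev u F.
Proof. by rewrite rmorphB rmorphXn /= ev2_C evX ev2_polyC. Qed.

Lemma ev2_morph (s : {rmorphism K -> K}) u v P : fixes_constants iota s ->
  s (ev2 u v P) = ev2 (s u) (s v) P.
Proof.
move=> sk; elim/poly_ind: P => [|P c IH]; first by rewrite !rmorph0.
by rewrite !(rmorphD, rmorphM) /= !ev2_X IH !ev2_C ev_morph.
Qed.

Lemma plane_model_morph P u v (s t : {rmorphism K -> K}) : fixes_constants iota s ->
  cancel t s -> plane_model iota P u v -> plane_model iota P (s u) (s v).
Proof.
move=> sk tK [P0 PQ gen]; split=> // [Q|z].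
  by rewrite -PQ !eval_atE -ev2_morph //; split=> [/eqP|->];
    rewrite ?rmorph0 // fmorph_eq0 => /eqP.
have [A [B [B0 Ez]]] := gen (t z); exists A, B.
by rewrite !eval_atE -!ev2_morph // fmorph_eq0 -fmorph_div -Ez tK.
Qed.

(** The coordinates of two plane models of the same curve correspond under an
    automorphism, since both identify K with the fraction field of k[X,Y]/(P). *)
Lemma plane_model_auto P u v u' v' :
    plane_model iota P u v -> plane_model iota P u' v' ->
  exists s : {rmorphism K -> K},
    [/\ bijective s, fixes_constants iota s, s u = u' & s v = v'].
Proof.
have transfer a b a' b' : plane_model iota P a b -> plane_model iota P a' b' ->
    exists f : K -> K, forall A B, ev2 a b B != 0 ->
      ev2 a' b' B != 0 /\ f (ev2 a b A / ev2 a b B) = ev2 a' b' A / ev2 a' b' B.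
  move=> [P0 PQ gen] [_ PQ' _].
  have same Q : ev2 a b Q = 0 <-> ev2 a' b' Q = 0.
    by split=> [/PQ|/PQ'] h; [apply/PQ' | apply/PQ].
  have sameN Q : ev2 a b Q != 0 -> ev2 a' b' Q != 0.
    by apply: contraNneq => /same ->.
  have ex z : exists AB : {poly {poly k}} * {poly {poly k}},
      (ev2 a b AB.2 != 0) && (z == ev2 a b AB.1 / ev2 a b AB.2).
    have [A [B [B0 Ez]]] := gen z; exists (A, B); rewrite B0; exact/eqP.
  pose f z := let AB := xchoose (ex z) in ev2 a' b' AB.1 / ev2 a' b' AB.2.
  exists f => A B B0; split; first exact: sameN.
  set z := ev2 a b A / ev2 a b B; have := xchooseP (ex z); rewrite /f.
  move: (xchoose (ex z)) => [C D] /= /andP[D0]; rewrite {}/z.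
  rewrite eqr_div // -!rmorphM -subr_eq0 -rmorphB => /eqP/same/eqP.
  rewrite rmorphB subr_eq0 !rmorphM => E; apply/eqP.
  by rewrite eqr_div ?sameN // eq_sym.
move=> M M'; have [f Hf] := transfer _ _ _ _ M M'; have [g Hg] := transfer _ _ _ _ M' M.
have [_ _ gen] := M; have [_ _ gen'] := M'.
have fM : {morph f : z w / z * w}.
  move=> z w; have [A [B [B0 ->]]] := gen z; have [C [D [D0 ->]]] := gen w.
  rewrite !eval_atE in B0 D0 *.
  rewrite mulf_div -!rmorphM /= (Hf _ _ _).2 ?rmorphM ?mulf_neq0 //.
  by rewrite (Hf _ _ B0).2 (Hf _ _ D0).2 mulf_div.
have fB : {morph f : z w / z - w}.
  move=> z w; have [A [B [B0 ->]]] := gen z; have [C [D [D0 ->]]] := gen w.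
  rewrite !eval_atE in B0 D0 *.
  have [[B'0 ->] [D'0 ->]] := (Hf A _ B0, Hf C _ D0).
  have sub_frac (a b c d : K) : b != 0 -> d != 0 ->
      a / b - c / d = (a * d - c * b) / (b * d).
    by move=> b0 d0; field; rewrite b0 d0.
  rewrite !sub_frac // -!rmorphM -rmorphB /= (Hf _ _ _).2;
    last by rewrite rmorphM mulf_neq0.
  by rewrite rmorphB !rmorphM.
have f_ev A : f (ev2 u v A) = ev2 u' v' A.
  by have := Hf A 1; rewrite !rmorph1 !divr1 => /(_ (oner_neq0 _))[_].
have f1 : f 1 = 1 by have := f_ev 1; rewrite !rmorph1.
pose fz := GRing.isZmodMorphism.Build K K f fB.
pose fm := GRing.isMonoidMorphism.Build K K f (conj f1 fM).
pose s : {rmorphism K -> K} := HB.pack f fz fm.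
exists s; split.
- exists g => z.
    have [A [B [B0 ->]]] := gen z.
    by have [B'0 E] := Hf A _ B0; rewrite /= E (Hg _ _ B'0).2.
  have [A [B [B0 ->]]] := gen' z.
  by have [B'0 E] := Hg A _ B0; rewrite /= E (Hf _ _ B'0).2.
- by move=> a; have := f_ev a%:P%:P; rewrite !ev2_C !evC.
- by have := f_ev 'X; rewrite !ev2_X.
- by have := f_ev 'Y; rewrite !ev2_C !evX.
Qed.

(** K is the extension of k(u) by a square root v of F(u).  Unlike a plane model, this
    is visibly preserved when u and v are changed within k(u) and k(u) v. *)
Record hyp_model F u v : Prop := HypModel {
  hm_transc : transcendental u;
  hm_eqn : v ^+ 2 = ev u F;
  hm_notin : ~ inRat u v;
  hm_gen : forall z, exists a b, [/\ inRat u a, inRat u b & z = a + b * v] }.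

Lemma hyperelliptic_reduce F Q : exists A q0 q1,
  Q = A * hyperelliptic_eqn F + q0^:P + q1^:P * 'Y.
Proof.
set P := hyperelliptic_eqn F.
have EP : 'Y ^+ 2 = P + F^:P by rewrite /P /hyperelliptic_eqn subrK.
have cst (c : {poly k}) : exists A q0 q1, c%:P = A * P + q0^:P + q1^:P * 'Y.
  elim/poly_ind: c => [|c a [A [q0 [q1 IH]]]].
    by exists 0, 0, 0; rewrite !rmorph0 !mul0r !addr0.
  exists (A * 'Y + q1^:P), (q1 * F + a%:P), q0.
  rewrite rmorphD rmorphM /= IH !(rmorphD, rmorphM) /= map_polyC /=.
  have -> : (A * P + q0 ^:P + q1 ^:P * 'Y) * 'Y =
    A * 'Y * P + q0^:P * 'Y + q1^:P * 'Y ^+ 2 by ring.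
  by rewrite EP; ring.
elim/poly_ind: Q => [|Q c [A [q0 [q1 IH]]]].
  by exists 0, 0, 0; rewrite !rmorph0 !mul0r !addr0.
have [A' [r0 [r1 ->]]] := cst c.
exists (A * 'X + A'), (q0 * 'X + r0), (q1 * 'X + r1).
rewrite {1}IH !(rmorphD, rmorphM) /= map_polyX; ring.
Qed.

Lemma swap_hyperelliptic_eqn F : swapXY (hyperelliptic_eqn F) = 'X^2 - F%:P.
Proof. by rewrite rmorphB rmorphXn /= swapXY_Y swapXY_map_polyC. Qed.

Lemma hyperelliptic_eqn_neq0 F : hyperelliptic_eqn F != 0.
Proof.
by rewrite -swapXY_eq0 swap_hyperelliptic_eqn -size_poly_eq0 size_XnsubC.
Qed.

(** The equation is monic of degree two in Y. *)
Lemma hyperelliptic_small F A q0 q1 :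
  q0^:P + q1^:P * 'Y = A * hyperelliptic_eqn F -> q0 = 0 /\ q1 = 0.
Proof.
move/(congr1 swapXY); rewrite rmorphD !rmorphM /= swap_hyperelliptic_eqn.
rewrite swapXY_Y !swapXY_map_polyC => E.
have A0 : swapXY A = 0.
  apply/eqP; apply: contraT => A0.
  have : (size (q0%:P + q1%:P * 'X)%R <= 2)%N.
    by rewrite addrC mul_polyC size_lin.
  rewrite E size_mul ?A0 // -?size_poly_eq0 ?size_XnsubC // addn3 /=.
  by rewrite -size_poly_eq0 in A0; case: (size _) A0.
move: E; rewrite A0 mul0r => E.
have := congr1 (fun r : {poly {poly k}} => r`_0) E.
have := congr1 (fun r : {poly {poly k}} => r`_1) E.
by rewrite !(coefD, coefC, coefMX, coef0) /= add0r addr0.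
Qed.

Lemma ev2_reduced F u v A q0 q1 : v ^+ 2 = ev u F ->
  ev2 u v (A * hyperelliptic_eqn F + q0^:P + q1^:P * 'Y) = ev u q0 + ev u q1 * v.
Proof.
move=> Ev; have := ev2_eqn u v F; rewrite Ev subrr.
move: (hyperelliptic_eqn F) => P EP; rewrite !(rmorphD, rmorphM) /= EP mulr0 add0r.
by rewrite !ev2_polyC ev2_C evX.
Qed.

Lemma plane_model_hyp_model F u v :
  plane_model iota (hyperelliptic_eqn F) u v <-> hyp_model F u v.
Proof.
split=> [[_ PQ gen] | [tu Ev nv gen]].
  have small q0 q1 : ev u q0 + ev u q1 * v = 0 -> q0 = 0 /\ q1 = 0.
    move=> E; have /PQ[A EA] : eval_at iota (q0^:P + q1^:P * 'Y) u v = 0.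
      by rewrite eval_atE rmorphD rmorphM /= !ev2_polyC ev2_C evX.
    exact: hyperelliptic_small EA.
  have Ev : v ^+ 2 = ev u F.
    apply/eqP; rewrite -subr_eq0 -ev2_eqn; apply/eqP/PQ.
    by exists 1; rewrite mul1r.
  have tu : transcendental u.
    by move=> p pu; apply: (small p 0 _).1; rewrite pu rmorph0 mul0r addr0.
  have red Q : exists q0 q1, ev2 u v Q = ev u q0 + ev u q1 * v.
    have [A [q0 [q1 EQ]]] := hyperelliptic_reduce F Q; exists q0, q1.
    by rewrite EQ ev2_reduced.
  have nv : ~ inRat u v.
    move=> [p [q [q0 Ep]]].
    have /small[_ Eq] : ev u (- p) + ev u q * v = 0.
      by rewrite rmorphN /= Ep mulrC divfK // addNr.
    by rewrite Eq rmorph0 eqxx in q0.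
  split=> // z; have [A [B [B0 ->]]] := gen z; rewrite !eval_atE in B0 *.
  have [a0 [a1 ->]] := red A; have [b0 [b1 EB]] := red B; rewrite EB in B0 *.
  have n0 : ev u b0 - ev u b1 * v != 0.
    apply/negP=> /eqP h; have /small[b00 b10] : ev u b0 + ev u (- b1) * v = 0.
      by rewrite rmorphN mulNr.
    by case/negP: B0; rewrite b00 -[b1]opprK b10 oppr0 !rmorph0 mul0r addr0.
  (* N(u) is the norm over k(u) of the denominator b0(u) + b1(u) v. *)
  pose N := b0 ^+ 2 - b1 ^+ 2 * F.
  have EN : ev u N = (ev u b0 - ev u b1 * v) * (ev u b0 + ev u b1 * v).
    by rewrite rmorphB /= (rmorphM (ev u) _ F) !rmorphXn /= -Ev; ring.
  have N0 : ev u N != 0 by rewrite EN mulf_neq0.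
  exists (ev u (a0 * b0 - a1 * b1 * F) / ev u N),
         (ev u (a1 * b0 - a0 * b1) / ev u N); split.
  - by apply: inRat_div; apply: inRat_ev.
  - by apply: inRat_div; apply: inRat_ev.
  rewrite EN !(rmorphB, rmorphM) /= -Ev; field.
  by rewrite n0 B0.
have small q0 q1 : ev u q0 + ev u q1 * v = 0 -> q0 = 0 /\ q1 = 0.
  move=> E; have q10 : ev u q1 = 0.
    apply/eqP; apply: contraT => q10; case: nv; exists (- q0), q1; split=> //.
    apply: (mulIf q10); rewrite divfK // rmorphN mulrC.
    by apply/eqP; rewrite -addr_eq0 addrC E.
  by move: E; rewrite q10 mul0r addr0 => /tu ->; split=> //; apply: tu.
split=> [|Q|z]; first exact: hyperelliptic_eqn_neq0.
  rewrite eval_atE; split=> [|[A ->]]; last by rewrite rmorphM /= ev2_eqn Ev subrr mulr0.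
  have [A [q0 [q1 ->]]] := hyperelliptic_reduce F Q.
  rewrite ev2_reduced // => /small[-> ->]; exists A.
  by rewrite !rmorph0 mul0r !addr0.
have [a [b [[p [q [q0 ->]]] [r [s [s0 ->]]] ->]]] := gen z.
exists ((p * s)^:P + (r * q)^:P * 'Y), (q * s)^:P.
rewrite !eval_atE rmorphD /= (rmorphM (ev2 u v) _ 'Y) /= !ev2_polyC ev2_C evX.
by rewrite !rmorphM /= mulf_neq0 //; split=> //; field; rewrite q0 s0.
Qed.

Lemma hyp_model_change F u v G x y r : hyp_model F u v -> sameRat iota u x ->
  inRat u r -> r != 0 -> y = r * v -> y ^+ 2 = ev x G -> hyp_model G x y.
Proof.
move=> [tu Ev nv gen] [ux xu] ur r0 Ey Ey2.
have Evy : v = r^-1 * y by rewrite Ey mulKf.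
split=> //; first exact: transc_of_inRat xu.
  move=> xy; apply: nv; rewrite Evy.
  by apply: inRatM (inRatV ur) _; apply: inRat_trans xy.
move=> z; have [a [b [ua ub ->]]] := gen z; exists a, (b / r); split.
- exact: inRat_trans ua.
- by apply: inRat_trans xu _; apply: inRat_div.
by rewrite Evy mulrA.
Qed.

Hypothesis char0 : [pchar k] =i pred0.

(** Writing z = a + b v, the square z^2 lies in k(u) only if a b = 0. *)
Lemma hyp_model_square F u v z : hyp_model F u v -> ~ inRat u z -> inRat u (z ^+ 2) ->
  exists r, [/\ inRat u r, r != 0 & z = r * v].
Proof.
move=> [tu Ev nv gen] nz uz2; have [a [b [ua ub Ez]]] := gen z.
have b0 : b != 0 by apply/negP=> /eqP b0; apply: nz; rewrite Ez b0 mul0r addr0.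
have [a0|a0] := eqVneq a 0; first by exists b; rewrite Ez a0 add0r.
have two0 : 2%:R != 0 :> K by rewrite -(rmorph_nat iota) fmorph_eq0 char0_natf.
case: nv; have -> : v = (z ^+ 2 - a ^+ 2 - b ^+ 2 * ev u F) / (2%:R * a * b).
  by rewrite Ez -Ev; field; rewrite two0 a0 b0.
have u2 : inRat u 2%:R by rewrite -(rmorph_nat iota); apply: inRat_iota.
apply: inRat_div; last by apply: inRatM ub; apply: inRatM.
apply: inRatB; first by apply: inRatB => //; apply: inRatX.
by apply: inRatM; [apply: inRatX | apply: inRat_ev].
Qed.

(** If z = (p / q) v with p, q coprime and z^2 = N(u), then q^2 N = p^2 F; as F is
    square-free, q is constant and N has at least the degree of F. *)
Lemma separable_high_genus F u v : hyp_model F u v -> separable_poly F ->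
  (7 < size F)%N -> high_genus iota u.
Proof.
move=> M sepF sF z N nz Ez.
have [|r [ur r0 Ezr]] := hyp_model_square M nz; first by rewrite Ez; apply: inRat_ev.
have tu := hm_transc M; have [p [q [cpq q0 Er]]] := inRat_coprime ur.
have E : q ^+ 2 * N = p ^+ 2 * F.
  apply: (transc_inj tu); rewrite !rmorphM /= -Ez -(hm_eqn M).
  by rewrite Ezr Er; field.
have qn0 : q != 0 by apply: contraNneq q0 => ->; rewrite rmorph0.
have pn0 : p != 0.
  by apply: contraNneq r0 => p0; rewrite Er p0 rmorph0 mul0r.
have qF : q * q %| F.
  have cqp : coprimep (q ^+ 2) (p ^+ 2).
    by rewrite coprimep_expl // coprimep_expr // coprimep_sym.
  by rewrite -expr2 -(Gauss_dvdpr F cqp) -E dvdp_mulr.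
have sq : size q = 1%N.
  apply/eqP; have /separable_polyP[sp _] := sepF.
  by have := sp _ _ qF; rewrite coprimepp.
have F0 : F != 0 by rewrite -size_poly_gt0 (leq_trans _ sF).
have N0 : N != 0.
  apply: contraTneq pn0 => N0; move/eqP: E.
  by rewrite N0 mulr0 eq_sym mulf_eq0 (negPf F0) orbF expf_eq0 /= => ->.
have := congr1 (fun f => size (f : {poly k})) E.
have /eqP/size_poly1P[c c0 Eq] := sq.
rewrite Eq -rmorphXn size_Cmul ?expf_neq0 // => ->.
rewrite size_mul ?expf_neq0 //.
have : (0 < size (p ^+ 2))%N by rewrite size_poly_gt0 expf_neq0.
by case: (size (p ^+ 2)) => // n _; rewrite (leq_trans sF) // addSn /= leq_addl.
Qed.

Lemma hyp_model_neg F u v : hyp_model F u v -> hyp_model F u (- v).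
Proof.
move=> M; apply: (hyp_model_change M _ (r := - 1)).
- by split; apply: inRat_id.
- by apply/inRatN/inRat1.
- by rewrite oppr_eq0 oner_eq0.
- by rewrite mulN1r.
- by rewrite sqrrN (hm_eqn M).
Qed.

(** As (u, v) and (u, -v) satisfy the same equation, (u, v) |-> (u, -v) is an automorphism. *)
Lemma hyp_model_inv F u v : hyp_model F u v -> high_genus iota u ->
  exists s : {rmorphism K -> K}, bijective s /\ hyp_inv iota s u v.
Proof.
move=> M hg; have [tu Ev nv gen] := M.
have [s [sb sk su sv]] := plane_model_auto
  (iffRL (plane_model_hyp_model _ _ _) M)
  (iffRL (plane_model_hyp_model _ _ _) (hyp_model_neg M)).
exists s; split=> //.
have fixu z : inRat u z -> s z = z by apply: inRat_fix.
have v0 : v != 0 by apply/negP=> /eqP v0; apply: nv; rewrite v0; apply: inRat0.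
have two0 : 2%:R != 0 :> K by rewrite -(rmorph_nat iota) fmorph_eq0 char0_natf.
split=> // z.
  have [a [b [ua ub ->]]] := gen z.
  have sE w : s (a + b * w) = a + b * s w.
    by rewrite rmorphD rmorphM /= (fixu a ua) (fixu b ub).
  by rewrite sE sv sE rmorphN /= sv opprK.
split=> [|/fixu //]; have [a [b [ua ub ->]]] := gen z.
rewrite rmorphD rmorphM /= sv !fixu // mulrN => /addrI/esym bv.
have [-> |/(anti_neq iota char0)/(_ bv)//] := eqVneq (b * v) 0.
by rewrite addr0.
Qed.

End PlaneModels.

(** * The group Z_2 x D_8 *)

Section GroupOrders.

Local Open Scope group_scope.

Lemma card_Z2D8 : #|('Z_2 * 'D_8 : finGroupType)%type| = 16.
Proof.
have := @card_2dihedral 3 isT; rewrite cardsT => D8.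
by rewrite card_prod card_ord D8.
Qed.

(** Outside the subgroup of rotations, which has order four, all elements are
    involutions. *)
Lemma expg4_D8 (g : 'D_8) : g ^+ 4 = 1.
Proof.
have isoD : [set: 'D_8] \isog [set: 'D_(2 ^ 3)] := isog_refl _.
have [[x y] gen _] := @generators_2dihedral _ [set: 'D_8]%G 3 isT isoD.
have [[_ outX _] _ _ _ _] := @dihedral2_structure _ [set: 'D_8]%G 3 x y isT gen isoD.
have [_ _ /= ox _] := gen.
have x4 : x ^+ 4 = 1 by have := expg_order x; rewrite ox.
have [/cycleP[i ->]|gX] := boolP (g \in <[x]>).
  by rewrite -expgM mulnC expgM x4 expg1n.
have og : #[g] = 2 by apply: outX; rewrite !inE gX.
have := expg_order g; rewrite og => g2.
by rewrite (expgM g 2 2) g2 expg1n.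
Qed.

Lemma expg4_Z2D8 (g : ('Z_2 * 'D_8 : finGroupType)%type) : g ^+ 4 = 1.
Proof.
have -> : g ^+ 4 = (g.1 ^+ 4, g.2 ^+ 4) by [].
rewrite expg4_D8; congr pair; case: g => [[[|[|m]] lt_m] d] //=; exact/val_inj.
Qed.

End GroupOrders.

(** * The normal form *)

Section NormalForm.

Variables (k : closedFieldType) (K : fieldType) (iota : {rmorphism k -> K}).
Hypothesis char0 : [pchar k] =i pred0.
Implicit Types (u v w x y z : K) (p q F G : {poly k}) (s : {rmorphism K -> K}).
Local Notation ev := (ev iota).
Local Notation inRat := (inRat iota).
Local Notation transcendental := (transcendental iota).
Local Notation sameRat := (sameRat iota).
Local Notation high_genus := (high_genus iota).
Local Notation hyp_model := (hyp_model iota).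

Lemma hyp_model_v0 F u v : hyp_model F u v -> v != 0.
Proof.
by move=> M; apply/negP=> /eqP v0; apply: (hm_notin M); rewrite v0; apply: inRat0.
Qed.

(** A square factor T^2 of the equation can be divided out of v. *)
Lemma high_genus_sqr_free F u v T F0 : hyp_model F u v -> high_genus u ->
  F = T ^+ 2 * F0 -> (7 < size F0)%N.
Proof.
move=> M hg EF; have [tu Ev nv _] := M.
have vv0 := hyp_model_v0 M.
have T0 : ev u T != 0.
  apply: contraNneq vv0 => T0; rewrite -sqrf_eq0 Ev EF rmorphM rmorphXn /= T0.
  by rewrite expr0n mul0r.
apply: (hg (v / ev u T)).
  move=> h; apply: nv; rewrite -(divfK T0 v).
  by apply: inRatM h _; apply: inRat_ev.
by rewrite expr_div_n Ev EF rmorphM rmorphXn /= mulrC mulKf ?expf_neq0.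
Qed.

(** Since y^2 = G(x) lies in k(u), y is a multiple of v by an element of k(u), and the
    transformed octavic H satisfies T^2 H = S^2 F with S and T coprime.  A nonconstant T
    would lower the genus, and a nonconstant S is excluded by the degree of H. *)
Lemma moebius_transfer F u v G x y a b c d : hyp_model F u v -> hyp_model G x y ->
    high_genus u -> (size F <= 9)%N -> (size G <= 9)%N ->
    sameRat u x -> ev u (c *: 'X + d%:P) != 0 ->
    x = ev u (a *: 'X + b%:P) / ev u (c *: 'X + d%:P) ->
  exists2 rho : k, rho != 0 & form_value 8 G (a *: 'X + b%:P) (c *: 'X + d%:P) = rho *: F.
Proof.
move=> M M' hg sF sG [ux xu] Q0 Ex.
set P := a *: 'X + b%:P in Ex *; set Q := c *: 'X + d%:P in Q0 Ex *.
pose H := form_value 8 G P Q.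
have sH : (size H <= 9)%N by rewrite size_form_value ?size_lin.
have tu := hm_transc M.
have ny : ~ inRat u y by move=> uy; apply: (hm_notin M'); apply: inRat_trans uy.
have [|r [ur r0 Ey]] := hyp_model_square char0 M ny.
  by rewrite (hm_eqn M'); apply: inRat_evw.
have EH : (y * ev u Q ^+ 4) ^+ 2 = ev u H.
  by rewrite ev_form_value // -Ex -(hm_eqn M'); ring.
have [S [T [cST T0 Er]]] : exists p q,
    [/\ coprimep p q, ev u q != 0 & r * ev u Q ^+ 4 = ev u p / ev u q].
  by apply: inRat_coprime; apply: inRatM ur _; apply: inRatX; apply: inRat_ev.
have E : T ^+ 2 * H = S ^+ 2 * F.
  apply: (transc_inj tu); rewrite !rmorphM /= -EH -(hm_eqn M) Ey.
  have -> : r * v * ev u Q ^+ 4 = (ev u S / ev u T) * v by rewrite -Er; ring.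
  by field.
have Tn0 : T != 0 by apply: contraNneq T0 => ->; rewrite rmorph0.
have Fn0 : F != 0.
  by apply: contraNneq (hyp_model_v0 M) => F0; rewrite -sqrf_eq0 (hm_eqn M) F0 rmorph0.
have Sn0 : S != 0.
  apply/negP=> /eqP S0; move: Er; rewrite S0 rmorph0 mul0r => /eqP.
  by rewrite mulf_eq0 (negPf r0) expf_eq0 (negPf Q0).
have /dvdpP[F0 EF] : T ^+ 2 %| F.
  have cTS : coprimep (T ^+ 2) (S ^+ 2).
    by rewrite coprimep_expl // coprimep_expr // coprimep_sym.
  by rewrite -(Gauss_dvdpr F cTS) -E dvdp_mulr.
have sF0 : (7 < size F0)%N by apply: (high_genus_sqr_free M hg (T := T)); rewrite mulrC.
have size_sqr (R : {poly k}) : R != 0 -> size (R ^+ 2) = (size R).-1.*2.+1.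
  by move=> R0; rewrite -[LHS]prednK ?size_poly_gt0 ?expf_neq0 // size_exp muln2.
have F0n0 : F0 != 0 by rewrite -size_poly_gt0 (leq_trans _ sF0).
have sT : size T = 1%N.
  move: sF; rewrite EF size_mul ?expf_neq0 // size_sqr // addnS /= => sF.
  apply/eqP; rewrite eqn_leq size_poly_gt0 Tn0 andbT.
  have := leq_trans (leq_add sF0 (leqnn _)) sF.
  by case: (size T) => [|[|m]] //=; rewrite doubleS !addnS.
have sFF : (7 < size F)%N.
  by rewrite EF size_mul ?expf_neq0 // size_sqr // sT /= addn1.
have sS : size S = 1%N.
  have := congr1 (fun f : {poly k} => size f) E.
  have Hn0 : H != 0.
    apply/negP=> /eqP H0; move: E; rewrite H0 mulr0 => /esym/eqP.
    by rewrite mulf_eq0 expf_eq0 /= (negPf Sn0) (negPf Fn0).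
  rewrite size_mul ?expf_neq0 // [RHS]size_mul ?expf_neq0 // !size_sqr // sT /=.
  rewrite double0 add0n => EsH.
  move: sH; rewrite EsH; apply: contraTeq => sS1; rewrite -ltnNge.
  have : (0 < size S)%N by rewrite size_poly_gt0.
  case: (size S) sS1 => [|[|m]] //= _ _; rewrite doubleS !addSn !ltnS.
  by rewrite (leq_trans sFF) // leq_addl.
have /eqP/size_poly1P[e e0 ET] := sT; have /eqP/size_poly1P[f f0 ES] := sS.
exists ((e ^+ 2)^-1 * f ^+ 2); first by rewrite mulf_neq0 ?invr_eq0 ?expf_neq0.
have ES2 : S ^+ 2 * F = f ^+ 2 *: F by rewrite ES -mul_polyC -polyC_exp.
rewrite -scalerA -ES2 -E ET -polyC_exp mul_polyC scalerA mulVf ?scale1r //.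
by rewrite expf_neq0.
Qed.

Lemma hyp_model_moebius F u v w : hyp_model F u v -> (size F <= 9)%N -> sameRat u w ->
  exists F' v', (size F' <= 9)%N /\ hyp_model F' w v'.
Proof.
move=> M sF [uw wu]; have tw := transc_same (hm_transc M) (conj uw wu).
have [a [b [c [d [_ Q0 Eu]]]]] := moebius_of_mutual char0 tw wu uw.
set P := a *: 'X + b%:P in Eu; set Q := c *: 'X + d%:P in Q0 Eu.
exists (form_value 8 F P Q), (ev w Q ^+ 4 * v); split;
  first by rewrite size_form_value ?size_lin.
apply: (hyp_model_change M (r := ev w Q ^+ 4)) => //.
- by apply: inRat_trans uw _; apply: inRatX; apply: inRat_ev.
- by rewrite expf_neq0.
by rewrite ev_form_value // -Eu -(hm_eqn M); ring.
Qed.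

Lemma closed_nth_root n (c : k) : (0 < n)%N -> exists z : k, z ^+ n = c.
Proof.
move=> n0; have [z] := @solve_monicpoly k n (fun i => if i == 0%N then c else 0) n0.
case: n n0 => // n _; rewrite big_ord_recl /= big1 => [|i _]; last by rewrite mul0r.
by rewrite expr0 mulr1 addr0; exists z.
Qed.

Section WithGroup.

Variables (gT : finGroupType) (phi : gT -> {rmorphism K -> K}).
Hypothesis exp4 : forall g : gT, (g ^+ 4 = 1)%g.
Hypothesis card_gT : (8 < #|gT|)%N.
Hypothesis phi_aut : forall g, bijective (phi g) /\ (forall a, phi g (iota a) = iota a).
Hypothesis phiM : forall g h, phi (g * h)%g =1 phi g \o phi h.
Hypothesis phi_inj : forall g h, phi g =1 phi h -> g = h.
Hypothesis phi_surj : forall s : {rmorphism K -> K},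
  bijective s -> (forall a, s (iota a) = iota a) -> exists g, phi g =1 s.

Lemma phi_k g : fixes_constants iota (phi g).
Proof. by case: (phi_aut g). Qed.

Lemma phi1 z : phi 1%g z = z.
Proof. by apply: (fmorph_inj (phi 1%g)); have := phiM 1%g 1%g z; rewrite mulg1. Qed.

Lemma phiK g : cancel (phi g) (phi g^-1%g).
Proof. by move=> z; have := phiM g^-1%g g z; rewrite mulVg phi1. Qed.

Lemma phiVK g : cancel (phi g^-1%g) (phi g).
Proof. by move=> z; have := phiM g g^-1%g z; rewrite mulgV phi1. Qed.

Lemma phiX g n z : phi (g ^+ n)%g z = iter n (phi g) z.
Proof. by elim: n z => [|n IH] z; rewrite ?phi1 // expgS phiM /= IH. Qed.

Lemma phi_iter4 g z : iter 4 (phi g) z = z.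
Proof. by rewrite -phiX exp4 phi1. Qed.

(** The product of two hyperelliptic involutions comes from the group, so its fourth
    power is trivial. *)
Lemma hyp_inv_unique_aut s u v s' u' v' : hyp_inv iota s u v ->
  hyp_inv iota s' u' v' -> s =1 s'.
Proof.
move=> H H'.
have ex (t : {rmorphism K -> K}) x y : hyp_inv iota t x y -> exists g, phi g =1 t.
  move=> Ht; apply: phi_surj; last exact: hyp_k Ht.
  by exists t => z; apply: hyp_invol Ht z.
have [g Eg] := ex _ _ _ H; have [g' Eg'] := ex _ _ _ H'.
apply: (hyp_inv_unique char0 H H') => z.
rewrite -[RHS](phi_iter4 (g * g')%g) /=.
by rewrite !phiM /= !Eg' !Eg.
Qed.

Variables (F : {poly k}) (u v : K).
Hypothesis M : hyp_model F u v.
Hypothesis hg : high_genus u.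
Hypothesis sF : (size F <= 9)%N.

Let tu := hm_transc M.

Variables (g0 : gT).
Hypothesis Hg0 : hyp_inv iota (phi g0) u v.

(** A conjugate of a hyperelliptic involution is again one. *)
Lemma phi_central g z : phi g0 (phi g z) = phi g (phi g0 z).
Proof.
have H' := hyp_inv_conj Hg0 (@phi_k g) (@phiK g) (@phiVK g).
by rewrite (hyp_inv_unique_aut Hg0 H') /= phiK.
Qed.

Lemma phi_same w g : sameRat u w -> sameRat w (phi g w).
Proof.
move=> uw; have into h : inRat w (phi h w).
  apply: inRat_trans uw.2 _; apply/(hyp_fix Hg0).
  by rewrite phi_central; congr (phi _ _); apply/(hyp_fix Hg0); case: uw.
split=> //; rewrite -{2}(phiVK g w).
by apply: inRat_morph (into _); apply: phi_k.
Qed.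

(** An element that is trivial on k(u) acts on v by a sign. *)
Lemma phi_fix w g : sameRat u w -> phi g w = w -> g \in [:: 1; g0]%g.
Proof.
move=> uw gw; have gu : phi g u = u by apply: inRat_fix gw uw.2; apply: phi_k.
have fixu z : inRat u z -> phi g z = z by apply: inRat_fix gu; apply: phi_k.
have decomp z := hm_gen M z.
have /eqP : phi g v ^+ 2 = v ^+ 2.
  by rewrite -rmorphXn (hm_eqn M) fixu //; apply: inRat_ev.
rewrite eqf_sqr !inE => /orP[]/eqP gv; apply/orP; [left|right]; apply/eqP/phi_inj => z;
  have [a [b [ua ub ->]]] := decomp z; rewrite !(rmorphD, rmorphM) /= gv.
  by rewrite !phi1 !fixu.
by rewrite !fixu // (hyp_anti Hg0) !(iffRL (hyp_fix Hg0 _)).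
Qed.

Lemma pick_outside (L : seq gT) : (size L < #|gT|)%N -> exists g, g \notin L.
Proof.
move=> sL; apply/existsP; apply: contraLR sL => /existsPn LT; rewrite -leqNgt.
apply: leq_trans (card_size L); apply: subset_leq_card; apply/subsetP=> g _.
exact/negPn/LT.
Qed.

(** The group induced on k(u) has more than four elements, so it is not of exponent two.
    In a group of exponent two containing r : w |-> - w, all elements commute with r and
    are thus of the form w |-> e w or w |-> e / w.  Those of the first form are 1 and r,
    and two of the second form differ by one of the first, which leaves room for four
    elements only. *)
Lemma exists_order4 : exists r : gT, (r ^+ 2)%g \notin [:: 1; g0]%g.
Proof.
apply/existsP; apply: contraT => /existsPn sq.
have invol g z : inRat u z -> phi g (phi g z) = z.
  move=> uz; have /negPn := sq g; rewrite -[LHS]/(iter 2 (phi g) z) -phiX !inE.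
  by case/orP=> /eqP ->; [rewrite phi1 | apply/(hyp_fix Hg0)].
have [r r1] : exists r, r \notin [:: 1; g0]%g.
  by apply: pick_outside; apply: leq_trans card_gT.
have [w [c [uw rw]]] := linearize (n := 2) char0 tu (@phi_k r) isT
  (invol r u (inRat_id _ _)) (phi_same r (conj (inRat_id _ _) (inRat_id _ _))).
have tw := transc_same tu uw; have w0 := transc_n0 tw.
have scal g e : phi g w = iota e * w -> phi g w = w \/ phi g w = - w.
  move=> gw; have := invol g w uw.1; rewrite gw rmorphM /= (@phi_k g) gw mulrA => /eqP.
  rewrite -subr_eq0 -{2}[w]mul1r -mulrBl mulf_eq0 (negPf w0) orbF subr_eq0.
  rewrite -expr2 -(expr1n _ 2) eqf_sqr => /orP[]/eqP ->; rewrite ?mul1r ?mulN1r.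
    by left.
  by right.
have {c} rw : phi r w = - w.
  by have [/(phi_fix uw) rr|//] := scal r c rw; rewrite rr in r1.
have scal4 g e : phi g w = iota e * w -> g \in [:: 1; g0; r; r * g0]%g.
  case/scal=> gw.
    by move: (phi_fix uw gw); rewrite !inE => /orP[]->; rewrite ?orbT.
  have rVw : phi r^-1%g w = - w by rewrite -[w]opprK -rw rmorphN phiK opprK.
  have /(phi_fix uw) : phi (r^-1 * g)%g w = w by rewrite phiM /= gw rmorphN /= rVw opprK.
  rewrite -{2}[g](mulKVg r) !inE => /orP[]/eqP->; by rewrite ?mulg1 eqxx !orbT.
have stab g z : inRat u z -> inRat u (phi g z).
  by move/(hyp_fix Hg0) => Ez; apply/(hyp_fix Hg0); rewrite phi_central Ez.
have r_odd g : phi r (phi g w) = - phi g w.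
  have uy := stab g w uw.1.
  have := invol (r * g)%g w uw.1; rewrite !phiM /= => /(congr1 (phi r)).
  rewrite rw invol; last by do 3! apply: (stab); exact: uw.1.
  move/(congr1 (phi g)); rewrite rmorphN /= invol //; exact: stab.
have form g : exists e, phi g w = iota e * w \/ phi g w = iota e / w.
  have [wy yw] := phi_same g uw.
  have [a [b [c [d [det0 Q0 Ey]]]]] := moebius_of_mutual char0 tw wy yw.
  have evL e f : ev w (e *: 'X + f%:P) = iota e * w + iota f.
    by rewrite rmorphD /= evZ evX evC.
  rewrite !evL in Q0 Ey.
  have Q0' : - (iota c * w) + iota d != 0.
    by rewrite -(fmorph_eq0 (phi r)) rmorphD rmorphN rmorphM /= !(@phi_k r) rw mulrN opprK.
  have := r_odd g; rewrite Ey fmorph_div !rmorphD !rmorphM /= !(@phi_k r) rw !mulrN.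
  rewrite -[RHS]mulNr => /eqP; rewrite eqr_div // -subr_eq0 => /eqP E.
  have /tw E2 : ev w ((- (a * c) *+ 2) *: 'X^2 + (b * d *+ 2)%:P) = 0.
    rewrite rmorphD /= evZ rmorphXn /= evX evC !rmorphMn rmorphN !rmorphM /=.
    by rewrite -E; ring.
  have n2 e : e *+ 2 = 0 -> e = 0 :> k.
    by move/eqP; rewrite -mulr_natr mulf_eq0 (negPf (char0_natf char0 1)) orbF => /eqP.
  have ac : a * c = 0.
    have := congr1 (fun f : {poly k} => f`_2) E2.
    rewrite coefD coefZ coefXn coefC coef0 mulr1 addr0 => /n2/eqP.
    by rewrite oppr_eq0 => /eqP.
  have bd : b * d = 0.
    have := congr1 (fun f : {poly k} => f`_0) E2.
    by rewrite coefD coefZ coefXn coefC coef0 mulr0 add0r => /n2.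
  have [a0|a0] := eqVneq a 0.
    have d0 : d = 0.
      apply/eqP; move/eqP: bd; rewrite mulf_eq0 => /orP[/eqP b0|//].
      by move: det0; rewrite a0 b0 !mul0r subrr eqxx.
    exists (b / c); right; rewrite a0 d0 rmorph0 mul0r add0r addr0 fmorph_div.
    by rewrite invfM mulrA.
  have c0 : c = 0 by move/eqP: ac; rewrite mulf_eq0 (negPf a0) => /eqP.
  have b0 : b = 0.
    apply/eqP; move/eqP: bd; rewrite mulf_eq0 => /orP[//|/eqP d0].
    by move: det0; rewrite c0 d0 !mulr0 subrr eqxx.
  exists (a / d); left; rewrite c0 b0 rmorph0 mul0r add0r addr0 fmorph_div.
  by rewrite mulrAC.
have [h hN] : exists h, h \notin [:: 1; g0; r; r * g0]%g.
  by apply: pick_outside; apply: leq_trans card_gT.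
have [a] := @pick_outside ([:: 1; g0; r; r * g0] ++
  [seq h^-1 * g | g <- [:: 1; g0; r; r * g0]])%g card_gT.
rewrite mem_cat negb_or => /andP[aN /negP[]].
have [e [/scal4 hL|hw]] := form h; first by rewrite hL in hN.
have [f [/scal4 aL|aw]] := form a; first by rewrite aL in aN.
rewrite -[a](mulKg h) map_f //; apply: (scal4 _ (f / e)).
by rewrite phiM /= aw fmorph_div (@phi_k h) hw fmorph_div invf_div mulrA mulrAC.
Qed.

(** In a coordinate w which an element of the group multiplies by a primitive fourth root
    of unity, the exponents of the octavic agree modulo four.  An octavic divisible by
    X^2, or of degree at most six, is excluded by the genus, so these exponents are
    0, 4 and 8. *)
Lemma quartic_octavic : exists F' w v', [/\ sameRat u w, hyp_model F' w v',
  (forall i, i \notin [:: 0; 4; 8]%N -> F'`_i = 0), F'`_0 != 0 & F'`_8 != 0].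
Proof.
have [r] := exists_order4; rewrite !inE negb_or => /andP[r1 r0].
have [w [c [uw rw]]] := linearize (n := 4) char0 tu (@phi_k r) isT
  (phi_iter4 r u) (phi_same r (conj (inRat_id _ _) (inRat_id _ _))).
have tw := transc_same tu uw; have w0 := transc_n0 tw.
have hw := high_genus_same char0 tu uw hg.
have rrw n : iter n (phi r) w = iota (c ^+ n) * w.
  elim: n => [|n IH]; first by rewrite rmorph1 mul1r.
  by rewrite /= IH rmorphM /= (@phi_k r) rw mulrA -rmorphM -exprSr.
have c4 : c ^+ 4 = 1.
  have := phi_iter4 r w; rewrite rrw => /eqP.
  rewrite -subr_eq0 -{2}[w]mul1r -mulrBl mulf_eq0 (negPf w0) orbF subr_eq0.
  by rewrite -(rmorph1 iota) (inj_eq (fmorph_inj iota)) => /eqP.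
have c2 : c ^+ 2 = -1.
  have /eqP : (c ^+ 2) ^+ 2 = 1 by rewrite -exprM.
  rewrite -[1 in X in X -> _](expr1n _ 2) eqf_sqr => /orP[/eqP c2|/eqP //].
  have : (r ^+ 2)%g \in [:: 1; g0]%g.
    by apply: (phi_fix uw); rewrite phiX rrw c2 rmorph1 mul1r.
  by rewrite !inE (negPf r1) (negPf r0).
have [G [y [sG MG]]] := hyp_model_moebius M sF uw.
have MG' : hyp_model G (phi r w) (phi r y).
  apply/plane_model_hyp_model; apply: (plane_model_morph (@phi_k r) (@phiVK r)).
  exact/plane_model_hyp_model.
have ev1 : ev w (0 *: 'X + 1%:P) = 1 by rewrite scale0r add0r evC rmorph1.
have [| |rho rho0 EG] := moebius_transfer (a := c) (b := 0) (c := 0) (d := 1)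
  MG MG' hw sG sG (phi_same r uw).
- by rewrite ev1 oner_neq0.
- by rewrite ev1 divr1 rmorphD /= evZ evX evC rmorph0 addr0.
rewrite polyC0 addr0 scale0r add0r in EG.
have {}EG i : (i < 9)%N -> c ^+ i * G`_i = rho * G`_i.
  move=> i9; have := congr1 (fun f : {poly k} => f`_i) EG.
  rewrite coefZ => <-; rewrite coef_sum (bigD1 (Ordinal i9)) //= big1 ?addr0.
    by rewrite expr1n mulr1 exprZn !coefZ coefXn eqxx mulr1 mulrC.
  move=> j ji; rewrite expr1n mulr1 exprZn !coefZ coefXn.
  by rewrite -val_eqE /= in ji; rewrite eq_sym (negPf ji) !mulr0.
have same i j : (i < 9)%N -> (j < 9)%N -> G`_j != 0 -> c ^+ i != c ^+ j -> G`_i = 0.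
  move=> i9 j9 Gj cij; apply/eqP; apply: contraT => Gi.
  have := EG i i9 => /(mulIf Gi) Ei; have := EG j j9 => /(mulIf Gj) Ej.
  by rewrite Ei Ej eqxx in cij.
have big i : (8 < i)%N -> G`_i = 0 by move=> i8; rewrite nth_default // (leq_trans sG).
have c0 : c != 0.
  by apply/eqP => c0; move: c4; rewrite c0 expr0n => /eqP; rewrite eq_sym oner_eq0.
have two0 : 2%:R != 0 :> k by rewrite char0_natf.
have m11 : -1 != 1 :> k.
  by rewrite -subr_eq0 -opprD oppr_eq0 -mulr2n.
have c1 : c != 1 by apply/negP=> /eqP c1; move: m11; rewrite -c2 c1 expr1n eqxx.
have cm1 : c != -1 by apply/negP=> /eqP c1'; move: m11; rewrite -c2 c1' sqrrN expr1n eqxx.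
have c3 : c ^+ 3 = - c by rewrite exprS c2 mulrN1.
have c5 : c ^+ 5 = c by rewrite exprS c4 mulr1.
have c6 : c ^+ 6 = -1 by rewrite (exprD c 4 2) c4 c2 mul1r.
have c7 : c ^+ 7 = - c by rewrite (exprD c 4 3) c4 c3 mul1r.
have c8 : c ^+ 8 = 1 by rewrite (exprD c 4 4) c4 mul1r.
have cNc : - c != c by rewrite -subr_eq0 -opprD oppr_eq0 -mulr2n -mulr_natr mulf_neq0.
have no_sqr (T F0 : {poly k}) : G = T ^+ 2 * F0 -> (size F0 <= 7)%N -> False.
  by move=> EGT; rewrite leqNgt (high_genus_sqr_free MG hw EGT).
have G01 : G`_0 = 0 -> G`_1 = 0 -> False.
  move=> G0 G1; apply: (no_sqr 'X (drop_poly 2 G)); last first.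
    by rewrite size_drop_poly leq_subLR.
  rewrite -{1}(poly_take_drop 2 G) mulrC.
  suff -> : take_poly 2 G = 0 by rewrite add0r.
  by apply/polyP=> -[|[|i]]; rewrite coef_take_poly coef0.
have G8 : G`_8 != 0.
  apply/negP=> /eqP G8.
  have G7 : G`_7 != 0.
    apply/negP=> /eqP G7; apply: (no_sqr 1 G); first by rewrite expr1n mul1r.
    apply/leq_sizeP=> -[|[|[|[|[|[|[|[|[|i]]]]]]]]] // _; exact: big.
  apply: G01; apply: (same _ 7) => //; rewrite c7 ?expr0 ?expr1 eq_sym //.
  by rewrite eqr_oppLR.
exists G, w, y; split=> //.
- move=> i; have [i8 _|i8 iN] := ltnP 8 i; first exact: big.
  apply: (same _ 8) => //; rewrite c8.
  case: i i8 iN => [|[|[|[|[|[|[|[|[|i]]]]]]]]] //= _ _;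
    rewrite ?expr1 ?c2 ?c3 ?c5 ?c6 ?c7 ?eqr_oppLR // eq_sym //.
- apply/negP=> /eqP G0; apply: (G01 G0); apply: (same _ 8) => //.
  by rewrite c8.
Qed.

(** Without a term in X^4 there would be an automorphism w |-> z w of order eight.  Hence
    w and y can be scaled to make the coefficients of X^8 and X^4 equal and the constant
    one; for t = 4 the octavic is a square. *)
Lemma normal_form : exists t : k, [/\ t != 0, t != 4%:R
  & exists x y, hyp_model (t *: 'X^8 + t *: 'X^4 + 1) x y].
Proof.
have [G [w [y [uw MG Gsupp G0 G8]]]] := quartic_octavic.
have tw := transc_same tu uw; have w0 := transc_n0 tw.
have hw := high_genus_same char0 tu uw hg.
have EG : G = G`_8 *: 'X^8 + G`_4 *: 'X^4 + (G`_0)%:P.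
  apply/polyP=> i; rewrite !coefD !coefZ !coefXn coefC.
  have [|iN] := boolP (i \in [:: 0; 4; 8]%N); last rewrite (Gsupp i iN); last first.
    move: iN; rewrite !inE !negb_or => /and3P[/negPf-> /negPf-> /negPf->].
    by rewrite !mulr0 !addr0.
  by rewrite !inE => /or3P[] /eqP ->; rewrite /= ?mulr0 ?mulr1 ?addr0 ?add0r.
have evG x : ev x G = iota G`_8 * x ^+ 8 + iota G`_4 * x ^+ 4 + iota G`_0.
  by rewrite {1}EG !rmorphD /= !evZ !rmorphXn /= evX evC.
have G4 : G`_4 != 0.
  apply/negP=> /eqP G4.
  have [z Ez] := closed_nth_root (-1) (isT : 0 < 4)%N.
  have z0 : z != 0.
    by apply: contra_eq_neq Ez => ->; rewrite expr0n eq_sym oppr_eq0 oner_eq0.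
  have Mz : hyp_model G (iota z * w) y.
    apply: (hyp_model_change MG (r := 1)); rewrite ?mul1r ?oner_neq0 //.
    - split; first by apply: inRatM; [apply: inRat_iota | apply: inRat_id].
      rewrite -{2}(mulKf (_ : iota z != 0) w) ?fmorph_eq0 //.
      by rewrite -fmorphV; apply: inRatM; [apply: inRat_iota | apply: inRat_id].
    - exact: inRat1.
    rewrite (hm_eqn MG) !evG G4 rmorph0 !mul0r !addr0 exprMn -rmorphXn.
    by rewrite (exprM z 4 2) Ez sqrrN expr1n rmorph1 mul1r.
  have [s [sb sk sw _]] := plane_model_auto
    (iffRL (plane_model_hyp_model _ _ _ _) MG) (iffRL (plane_model_hyp_model _ _ _ _) Mz).
  have [g Eg] := phi_surj sb sk.
  have E n : iter n (phi g) w = iota (z ^+ n) * w.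
    elim: n => [|n IH]; first by rewrite rmorph1 mul1r.
    by rewrite /= IH rmorphM /= (@phi_k g) Eg sw mulrA -rmorphM -exprSr.
  have := phi_iter4 g w; rewrite E Ez rmorphN rmorph1 mulN1r => /esym.
  exact: (anti_neq iota char0).
have two0 : 2%:R != 0 :> k by rewrite char0_natf.
have [d Ed] := closed_nth_root (G`_4 / G`_8) (isT : 0 < 4)%N.
have [e Ee] := closed_nth_root G`_0 (isT : 0 < 2)%N.
have d0 : d != 0.
  by apply: contra_eq_neq Ed => ->; rewrite expr0n eq_sym mulf_neq0 ?invr_eq0.
have e0 : e != 0 by apply: contra_eq_neq Ee => ->; rewrite expr0n eq_sym.
exists (G`_4 ^+ 2 / (G`_8 * G`_0)); split.
- by rewrite mulf_neq0 ?invr_eq0 ?mulf_neq0 ?expf_neq0.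
- apply/negP=> /eqP t4.
  have E4 : G`_0 = G`_8 * (G`_4 / (2%:R * G`_8)) ^+ 2.
    have -> : G`_0 = G`_4 ^+ 2 / (G`_8 * 4%:R).
      by rewrite -t4; field; rewrite G0 G4 G8.
    by field; rewrite G8 two0 char0_natf.
  have := @high_genus_sqr_free _ _ _ ('X^4 + (G`_4 / (2%:R * G`_8))%:P) (G`_8)%:P MG hw.
  rewrite ltnNge (leq_trans (size_polyC_leq1 _)) // => /(_ _)/negP; apply=> //.
  rewrite {1}EG E4; set g := G`_4 / _.
  have -> : G`_4 = G`_8 * g * 2%:R by rewrite /g; field; rewrite G8 two0.
  rewrite -!mul_polyC !polyCM; ring.
exists (w / iota d), (y / iota e).
have idn0 : iota d != 0 by rewrite fmorph_eq0.
have ien0 : iota e != 0 by rewrite fmorph_eq0.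
apply: (hyp_model_change MG (r := iota e^-1)).
- split; first by apply: inRat_div; [apply: inRat_id | apply: inRat_iota].
  rewrite -{2}(divfK idn0 w).
  by apply: inRatM; [apply: inRat_id | apply: inRat_iota].
- exact: inRat_iota.
- by rewrite fmorph_eq0 invr_eq0.
- by rewrite fmorphV mulrC.
rewrite expr_div_n (hm_eqn MG) evG !rmorphD /= !evZ !rmorphXn /= evX rmorph1.
have iEd : iota d ^+ 4 = iota G`_4 / iota G`_8 by rewrite -rmorphXn Ed fmorph_div.
have iEe : iota e ^+ 2 = iota G`_0 by rewrite -rmorphXn Ee.
have iG8 : iota G`_8 != 0 by rewrite fmorph_eq0.
have iG0 : iota G`_0 != 0 by rewrite fmorph_eq0.
have iG4 : iota G`_4 != 0 by rewrite fmorph_eq0.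
rewrite fmorph_div rmorphXn rmorphM /= !expr_div_n (exprM (iota d) 4 2) iEd iEe.
by field; rewrite iG8 iG0 iG4.
Qed.

End WithGroup.
End NormalForm.

(** * Transvectants *)

Section Transvection.

Variable k : closedFieldType.
Hypothesis char0 : [pchar k] =i pred0.
Implicit Types (f g h : {mpoly k[2]}) (M : 'M[k]_2).

Local Notation X := ('X_ord0 : {mpoly k[2]}).
Local Notation Z := ('X_ord_max : {mpoly k[2]}).

Definition lin_form (a b : k) : {mpoly k[2]} := a *: X + b *: Z.

Lemma mderiv_lin0 a b : (lin_form a b)^`M(ord0) = a%:MP.
Proof.
rewrite mderivD !mderivZ !mderivX !mnm1E /= scale0r scaler0 addr0.
by rewrite scale1r -{1}[U_(_)%MM]add0m addmK mpolyX0 alg_mpolyC.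
Qed.

Lemma mderiv_lin1 a b : (lin_form a b)^`M(ord_max) = b%:MP.
Proof.
rewrite mderivD !mderivZ !mderivX !mnm1E /= scale0r scaler0 add0r.
by rewrite scale1r -{1}[U_(_)%MM]add0m addmK mpolyX0 alg_mpolyC.
Qed.

Lemma mderiv_expn (i : 'I_2) (p : {mpoly k[2]}) c m : p^`M(i) = c%:MP ->
  (p ^+ m)^`M(i) = (c * m%:R) *: p ^+ m.-1.
Proof.
move=> dp; elim: m => [|m IH]; first by rewrite mulr0 scale0r expr0 -mpolyC1 mderivC.
rewrite exprS mderivM dp IH mul_mpolyC -scalerAr -exprS /=.
case: m {IH} => [|m]; first by rewrite !mulr1 mulr0 scale0r addr0.
by rewrite /= -scalerDl -[m.+2]add1n natrD mulrDr mulr1.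
Qed.

Lemma mderivn_expn (i : 'I_2) (p : {mpoly k[2]}) c m n : p^`M(i) = c%:MP ->
  (p ^+ m)^`M(i, n) = (c ^+ n * (m ^_ n)%:R) *: p ^+ (m - n).
Proof.
move=> dp; elim: n => [|n IH]; first by rewrite mderivn0 mulr1 scale1r subn0.
rewrite mderivnS IH mderivZ (mderiv_expn _ dp) scalerA; congr (_ *: _ ^+ _).
  by rewrite ffactnSr natrM exprSr; ring.
by rewrite subnS.
Qed.

Lemma ffactnD m i j : (m ^_ (i + j) = m ^_ i * (m - i) ^_ j)%N.
Proof.
elim: j => [|j IH]; first by rewrite addn0 muln1.
by rewrite addnS !ffactnSr IH subnDA mulnA.
Qed.

Lemma mderiv_lin_pow a b m i j :
  (lin_form a b ^+ m)^`M(ord0, i)^`M(ord_max, j) =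
  (a ^+ i * b ^+ j * (m ^_ (i + j))%:R) *: lin_form a b ^+ (m - (i + j)).
Proof.
rewrite (mderivn_expn _ _ (mderiv_lin0 a b)) mderivmZ.
rewrite (mderivn_expn _ _ (mderiv_lin1 a b)) scalerA subnDA; congr (_ *: _).
by rewrite ffactnD natrM; ring.
Qed.

(** In symbolic notation: the n-th transvectant of a^m and b^p is (ab)^n a^(m-n) b^(p-n),
    where (ab) is the determinant of the two linear forms. *)
Lemma transvection_pow m p a b a' b' n : (n <= m)%N -> (n <= p)%N ->
  transvection m p (lin_form a b ^+ m) (lin_form a' b' ^+ p) n =
  (a * b' - b * a') ^+ n *: (lin_form a b ^+ (m - n) * lin_form a' b' ^+ (p - n)).
Proof.
move=> nm np; rewrite /transvection.
have fact_neq0 j : j`!%:R != 0 :> k by case: j`! (fact_gt0 j) => // j' _; apply: char0_natf.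
rewrite exprBn scaler_sumr scaler_suml; apply: eq_bigr => i _.
have i_n : (i <= n)%N by rewrite -ltnS.
rewrite !mderiv_lin_pow subnK // subnKC // -scalerAl -scalerAr !scalerA.
congr (_ *: _).
rewrite -(ffact_fact nm) -(ffact_fact np) !natrM -mulr_natr !exprMn.
have ff j : (n <= j)%N -> (j ^_ n)%:R != 0 :> k.
  move=> nj; have := ffact_gt0 j n; rewrite nj.
  by case: (j ^_ n)%N => // j' _; apply: char0_natf.
by field; rewrite !fact_neq0 !ff.
Qed.

Lemma transvectionD_l m p n a f g h :
  transvection m p (a *: f + g) h n =
  a *: transvection m p f h n + transvection m p g h n.
Proof.
rewrite /transvection; set c := _ / _; rewrite [a *: (c *: _)]scalerA [a * c]mulrC.
rewrite -[(c * a) *: _]scalerA -scalerDr; congr (_ *: _).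
rewrite scaler_sumr -big_split; apply: eq_bigr => i _ /=.
by rewrite !mderivmD !mderivmZ mulrDl scalerDr -scalerAl !scalerA mulrC.
Qed.

Lemma transvectionD_r m p n a f g h :
  transvection m p h (a *: f + g) n =
  a *: transvection m p h f n + transvection m p h g n.
Proof.
rewrite /transvection; set c := _ / _; rewrite [a *: (c *: _)]scalerA [a * c]mulrC.
rewrite -[(c * a) *: _]scalerA -scalerDr; congr (_ *: _).
rewrite scaler_sumr -big_split; apply: eq_bigr => i _ /=.
by rewrite !mderivmD !mderivmZ mulrDr scalerDr -scalerAr !scalerA mulrC.
Qed.

Lemma transvectionZ m p n a b f g :
  transvection m p (a *: f) (b *: g) n = (a * b) *: transvection m p f g n.
Proof.
have l0 h : transvection m p 0 h n = 0.
  by have := transvectionD_l m p n (-1) 0 0 h; rewrite scaler0 addr0 scaleN1r addNr.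
have r0 h : transvection m p h 0 n = 0.
  by have := transvectionD_r m p n (-1) 0 0 h; rewrite scaler0 addr0 scaleN1r addNr.
rewrite -[a *: f]addr0 transvectionD_l l0 addr0 -[b *: g]addr0 transvectionD_r r0.
by rewrite addr0 scalerA.
Qed.

Definition mnm2 (i j : nat) : 'X_{1..2} := (U_(ord0) *+ i + U_(ord_max) *+ j)%MM.

Lemma mpolyX_mono2 i j : 'X_[mnm2 i j] = X ^+ i * Z ^+ j.
Proof. by rewrite mpolyXD !mpolyXn. Qed.

Lemma mono2E (m : 'X_{1..2}) : m = mnm2 (m ord0) (m ord_max).
Proof.
apply/mnmP=> -[[|[|//]] i2].
  have -> : Ordinal i2 = ord0 by apply: val_inj.
  by rewrite mnmDE !mulmnE !mnm1E /= mul1n mul0n addn0.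
have -> : Ordinal i2 = ord_max by apply: val_inj.
by rewrite mnmDE !mulmnE !mnm1E /= mul1n mul0n.
Qed.

Lemma mdeg_mono2 i j : mdeg (mnm2 i j) = (i + j)%N.
Proof. by rewrite mdegD !mdegMn !mdeg1 !mul1n. Qed.

Lemma mono2_0 i j : mnm2 i j ord0 = i.
Proof. by rewrite mnmDE !mulmnE !mnm1E /= mul1n mul0n addn0. Qed.

Lemma homog2_expand m f : f \is m.-homog ->
  f = \sum_(i < m.+1) f@_(mnm2 i (m - i)) *: (X ^+ i * Z ^+ (m - i)).
Proof.
move=> hf; apply/mpolyP=> e.
rewrite raddf_sum /=; under eq_bigr do rewrite mcoeffZ -mpolyX_mono2 mcoeffX.
have [em|em] := eqVneq (mdeg e) m; last first.
  rewrite (dhomog_nemf_coeff hf em) big1 // => i _.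
  case: eqP => [E|_]; last by rewrite mulr0.
  by move: em; rewrite -E mdeg_mono2 subnKC ?eqxx // -ltnS.
have Em : (e ord0 + e ord_max)%N = m by rewrite -em {3}(mono2E e) mdeg_mono2.
have e0 : (e ord0 < m.+1)%N by rewrite ltnS -Em leq_addr.
have Ee : e = mnm2 (e ord0) (m - e ord0) by rewrite -Em addKn -mono2E.
rewrite (bigD1 (Ordinal e0)) //= big1 ?addr0 => [|i ie]; first by rewrite -Ee eqxx mulr1.
case: eqP => [E|_]; last by rewrite mulr0.
by move: ie; rewrite -val_eqE /= -E mono2_0 eqxx.
Qed.

(** The powers of the linear forms X + s Z span the forms of degree m: if a functional
    phi vanishes on them, then the polynomial in s with coefficients
    C(m, i) phi(X^(m-i) Z^i) vanishes identically, so phi vanishes on all monomials. *)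
Lemma homog_pow_ext m (phi : {mpoly k[2]} -> k) :
    (forall a f g, phi (a *: f + g) = a * phi f + phi g) ->
    (forall s, phi (lin_form 1 s ^+ m) = 0) ->
  forall f, f \is m.-homog -> phi f = 0.
Proof.
move=> phi_lin phi_pow f hf.
have phi0 : phi 0 = 0.
  by have := phi_lin (-1) 0 0; rewrite scaler0 addr0 mulN1r addNr.
have phi_sum (I : finType) (c : I -> k) (h : I -> {mpoly k[2]}) :
    phi (\sum_i c i *: h i) = \sum_i c i * phi (h i).
  elim/big_rec2: _ => [|i a b _ IH]; first exact: phi0.
  by rewrite phi_lin IH.
pose P := \poly_(i < m.+1) (phi (X ^+ (m - i) * Z ^+ i) * 'C(m, i)%:R).
have P0 : P = 0.
  apply/eqP; apply: contraT => /closed_nonrootP[s /negP[]].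
  apply/eqP; rewrite horner_poly -[RHS](phi_pow s).
  have -> : lin_form 1 s ^+ m =
      \sum_(i < m.+1) (s ^+ i * 'C(m, i)%:R) *: (X ^+ (m - i) * Z ^+ i).
    rewrite /lin_form scale1r exprDn; apply: eq_bigr => i _.
    by rewrite exprZn -scalerAr -scaler_nat scalerA mulrC.
  by rewrite phi_sum; apply: eq_bigr => i _; ring.
have mon i : (i <= m)%N -> phi (X ^+ (m - i) * Z ^+ i) = 0.
  move=> im; have := congr1 (fun r : {poly k} => r`_i) P0.
  rewrite coef_poly ltnS im coef0 => /eqP; rewrite mulf_eq0 => /orP[/eqP //|].
  have := bin_gt0 m i; rewrite im; case: 'C(m, i) => // c _.
  by rewrite (negPf (char0_natf char0 c)).
rewrite (homog2_expand hf) phi_sum big1 // => i _.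
have im : (i <= m)%N by rewrite -ltnS.
by have := mon (m - i)%N (leq_subr _ _); rewrite subKn // => ->; rewrite mulr0.
Qed.

Lemma subst_formE M f : subst_form M f =
  f \mPo [tuple \sum_(j < 2) M i j *: 'X_j | i < 2].
Proof. by []. Qed.

Lemma subst_form_lin M a b : subst_form M (lin_form a b) =
  lin_form (a * M ord0 ord0 + b * M ord_max ord0)
    (a * M ord0 ord_max + b * M ord_max ord_max).
Proof.
rewrite subst_formE raddfD /= !comp_mpolyZ !comp_mpolyXU -!tnth_nth !tnth_mktuple.
rewrite !big_ord_recl !big_ord0 !addr0 /=.
have -> : lift ord0 ord0 = ord_max :> 'I_2 by apply: val_inj.
by rewrite /lin_form !scalerDr !scalerA !scalerDl; ring.
Qed.

Lemma subst_formD M a f g :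
  subst_form M (a *: f + g) = a *: subst_form M f + subst_form M g.
Proof. by rewrite !subst_formE comp_mpolyD comp_mpolyZ. Qed.

Lemma subst_formM M f g : subst_form M (f * g) = subst_form M f * subst_form M g.
Proof. exact: rmorphM. Qed.

Lemma subst_formX M f n : subst_form M (f ^+ n) = subst_form M f ^+ n.
Proof. exact: rmorphXn. Qed.

Lemma det2 M : \det M = M ord0 ord0 * M ord_max ord_max - M ord0 ord_max * M ord_max ord0.
Proof.
rewrite (expand_det_row _ ord0) !big_ord_recl big_ord0 addr0 /cofactor !det_mx11 !mxE.
have -> : lift ord0 ord0 = ord_max :> 'I_2 by apply: val_inj.
have -> : lift ord_max ord0 = ord0 :> 'I_2 by apply: val_inj.
by rewrite expr0 expr1 /=; ring.
Qed.

(** Transvectants are covariants.  By bilinearity it is enough to test powers of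
    linear forms, where the bracket of two linear forms is multiplied by det M. *)
Lemma transvection_subst M m p n f g : (n <= m)%N -> (n <= p)%N ->
    f \is m.-homog -> g \is p.-homog ->
  transvection m p (subst_form M f) (subst_form M g) n =
  (\det M) ^+ n *: subst_form M (transvection m p f g n).
Proof.
move=> nm np hf hg; apply/mpolyP=> e; apply/eqP; rewrite -subr_eq0; apply/eqP.
pose phi f g := (transvection m p (subst_form M f) (subst_form M g) n)@_e -
  ((\det M) ^+ n *: subst_form M (transvection m p f g n))@_e.
rewrite -/(phi f g); apply: (homog_pow_ext (phi := phi^~ g)) hf => [a f1 f2|s].
  rewrite /phi (subst_formD M a f1 f2) (transvectionD_l m p n a f1 f2 g).
  rewrite (transvectionD_l m p n a (subst_form M f1) (subst_form M f2) (subst_form M g)).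
  rewrite (subst_formD M a (transvection m p f1 g n) (transvection m p f2 g n)).
  move: (transvection m p (subst_form M f1) _ n) (transvection m p (subst_form M f2) _ n).
  move: (subst_form M _) (subst_form M _) => T1 T2 T3 T4.
  by rewrite scalerDr !mcoeffD !mcoeffZ; ring.
apply: (homog_pow_ext (phi := phi _)) hg => [a g1 g2|t].
  rewrite /phi (subst_formD M a g1 g2) (transvectionD_r m p n a g1 g2 (lin_form 1 s ^+ m)).
  rewrite (transvectionD_r m p n a (subst_form M g1) (subst_form M g2)
    (subst_form M (lin_form 1 s ^+ m))).
  rewrite (subst_formD M a (transvection m p (lin_form 1 s ^+ m) g1 n)
    (transvection m p (lin_form 1 s ^+ m) g2 n)).
  move: (transvection m p _ (subst_form M g1) n) (transvection m p _ (subst_form M g2) n).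
  move: (subst_form M _) (subst_form M _) => T1 T2 T3 T4.
  by rewrite scalerDr !mcoeffD !mcoeffZ; ring.
rewrite /phi !subst_formX !subst_form_lin !transvection_pow //.
rewrite -[_ *: (lin_form 1 s ^+ _ * _)]addr0 subst_formD [subst_form M 0]comp_mpoly0 addr0.
rewrite subst_formM !subst_formX !subst_form_lin scalerA -exprMn det2.
apply/eqP; rewrite subr_eq0; apply/eqP; congr (_ @_ _); congr (_ ^+ _ *: _).
by ring.
Qed.

Lemma transvection_homog m p n f g : (n <= m)%N -> (n <= p)%N ->
    f \is m.-homog -> g \is p.-homog ->
  transvection m p f g n \is ((m - n) + (p - n)).-homog.
Proof.
move=> nm np hf hg; rewrite /transvection rpredZ // rpred_sum // => i _.
have i_n : (i <= n)%N by rewrite -ltnS.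
have deriv_homog d h a b : (a + b = n)%N -> h \is d.-homog ->
    h^`M(ord0, a)^`M(ord_max, b) \is (d - n).-homog.
  move=> abn hh; apply/dhomogP=> e; rewrite mcoeff_msupp !mcoeff_mderivm.
  rewrite -mulrnA => /eqP h0.
  have hne : h@_(mnm2 a b + e) != 0.
    apply/negP=> /eqP h1; apply: h0.
    by rewrite /mnm2 -addmA in h1; rewrite h1 mul0rn.
  have := dhomog_mf hh; move=> /(_ (mnm2 a b + e)%MM).
  rewrite mcoeff_msupp hne => /(_ isT) /= <-.
  by rewrite /= mdegD mdeg_mono2 abn addKn.
by rewrite rpredZ // dhomogM // deriv_homog // ?subnK ?subnKC.
Qed.

End Transvection.

(** * The invariants J2, J4 and J6 *)

Section OctavicInvariants.

Variable k : closedFieldType.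
Hypothesis char0 : [pchar k] =i pred0.
Implicit Types (f g h : {mpoly k[2]}) (M : 'M[k]_2) (F G : {poly k}).

Local Notation X := ('X_ord0 : {mpoly k[2]}).
Local Notation Z := ('X_ord_max : {mpoly k[2]}).

Lemma homog_monomial i j : X ^+ i * Z ^+ j \is (i + j).-homog.
Proof. by rewrite -mpolyX_mono2 dhomogX; apply/eqP; apply: mdeg_mono2. Qed.

Lemma octavic_homog F : octavic F \is 8.-homog.
Proof.
rewrite rpred_sum // => i _; rewrite rpredZ //.
by have := homog_monomial i (8 - i); rewrite subnKC // -ltnS.
Qed.

Lemma subst_form_homog M m f : f \is m.-homog -> subst_form M f \is m.-homog.
Proof.
move=> hf; rewrite (homog2_expand hf) subst_formE raddf_sum /= rpred_sum // => i _.
rewrite comp_mpolyZ rpredZ // -subst_formE subst_formM !subst_formX.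
have lin_homog (a b : k) : lin_form a b \is 1.-homog.
  by rewrite rpredD // rpredZ // dhomogX; apply/eqP; apply: mdeg1.
have -> : X = lin_form 1 0 by rewrite /lin_form scale1r scale0r addr0.
have -> : Z = lin_form 0 1 by rewrite /lin_form scale1r scale0r add0r.
rewrite !subst_form_lin.
have prod_homog (a b c d : k) : lin_form a b ^+ i * lin_form c d ^+ (m - i) \is m.-homog.
  have := dhomogM (dhomogMn i (lin_homog a b)) (dhomogMn (m - i) (lin_homog c d)).
  by rewrite !mul1n subnKC // -ltnS.
exact: prod_homog.
Qed.

Lemma mcoeff0_subst M f : f \is 0.-homog -> (subst_form M f)@_0%MM = f@_0%MM.
Proof.
move=> hf; rewrite {1}(homog2_expand hf) big_ord_recl big_ord0 addr0 /=.
rewrite subst_formE comp_mpolyZ mulr1 comp_mpoly1 mcoeffZ mcoeff1 eqxx mulr1.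
by congr (_ @_ _); apply/eqP; rewrite -mdeg_eq0 mdeg_mono2.
Qed.

Lemma kappa_homog f : f \is 8.-homog -> kappa f \is 4.-homog.
Proof. by move=> hf; apply: (@transvection_homog _ 8 8 6). Qed.

Lemma hform_homog f : f \is 8.-homog -> hform f \is 4.-homog.
Proof. by move=> /kappa_homog hf; apply: (@transvection_homog _ 4 4 2). Qed.

Lemma kappa_subst M f : f \is 8.-homog ->
  kappa (subst_form M f) = \det M ^+ 6 *: subst_form M (kappa f).
Proof. by move=> hf; apply: transvection_subst. Qed.

Lemma hform_subst M f : f \is 8.-homog ->
  hform (subst_form M f) = \det M ^+ 14 *: subst_form M (hform f).
Proof.
move=> hf; rewrite /hform kappa_subst // transvectionZ transvection_subst //;
  try exact: kappa_homog.
by rewrite scalerA -!exprD.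
Qed.

Lemma J2_subst M f : f \is 8.-homog -> J2 (subst_form M f) = \det M ^+ 8 * J2 f.
Proof.
move=> hf; rewrite /J2 transvection_subst // mcoeffZ mcoeff0_subst; first by ring.
exact: (@transvection_homog _ 8 8 8).
Qed.

Lemma J4_subst M f : f \is 8.-homog -> J4 (subst_form M f) = \det M ^+ 16 * J4 f.
Proof.
move=> hf; have hk := kappa_homog hf.
rewrite /J4 kappa_subst // transvectionZ transvection_subst // mcoeffZ mcoeffZ.
rewrite mcoeff0_subst; first by ring.
exact: (@transvection_homog _ 4 4 4).
Qed.

Lemma J6_subst M f : f \is 8.-homog -> J6 (subst_form M f) = \det M ^+ 24 * J6 f.
Proof.
move=> hf; have hk := kappa_homog hf; have hh := hform_homog hf.
rewrite /J6 kappa_subst // hform_subst //.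
rewrite transvectionZ transvection_subst // mcoeffZ mcoeffZ.
rewrite mcoeff0_subst; first by ring.
exact: (@transvection_homog _ 4 4 4).
Qed.

Lemma kappaZ a f : kappa (a *: f) = a ^+ 2 *: kappa f.
Proof. exact: transvectionZ. Qed.

Lemma J2Z a f : J2 (a *: f) = a ^+ 2 * J2 f.
Proof. by rewrite /J2 transvectionZ mcoeffZ; ring. Qed.

Lemma J4Z a f : J4 (a *: f) = a ^+ 4 * J4 f.
Proof. by rewrite /J4 kappaZ transvectionZ mcoeffZ; ring. Qed.

Lemma J6Z a f : J6 (a *: f) = a ^+ 6 * J6 f.
Proof. by rewrite /J6 /hform kappaZ !transvectionZ mcoeffZ; ring. Qed.

(** J6 and J2 J4 have the same degree and the same weight. *)
Lemma t4_equivalent M rho F G : rho != 0 -> \det M != 0 ->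
  subst_form M (octavic G) = rho *: octavic F -> t4 F = t4 G.
Proof.
move=> r0 d0 E; have hG := octavic_homog G.
have := J2_subst M hG; have := J4_subst M hG; have := J6_subst M hG.
rewrite E J2Z J4Z J6Z => E6 E4 E2; rewrite /t4.
pose c := \det M ^+ 24 / rho ^+ 6.
have c0 : c != 0 by rewrite mulf_neq0 ?invr_eq0 ?expf_neq0.
have -> : J6 (octavic F) = c * J6 (octavic G).
  by apply: (mulfI (expf_neq0 6 r0)); rewrite E6 /c; field.
have -> : J2 (octavic F) * J4 (octavic F) = c * (J2 (octavic G) * J4 (octavic G)).
  apply: (mulfI (expf_neq0 6 r0)).
  transitivity ((rho ^+ 2 * J2 (octavic F)) * (rho ^+ 4 * J4 (octavic F))); first by ring.
  by rewrite E2 E4 /c; field.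
move: (J6 _) (J2 _ * J4 _) => j6 j24.
by rewrite -mulf_div (divff c0) mul1r.
Qed.

Definition affine_pt (x : k) (i : 'I_2) : k := if i == ord0 then x else 1.

Lemma homog_eval_inj m f g : f \is m.-homog -> g \is m.-homog ->
  (forall x, f.@[affine_pt x] = g.@[affine_pt x]) -> f = g.
Proof.
move=> hf hg fg.
have hpt h x : h \is m.-homog ->
    h.@[affine_pt x] = (\poly_(i < m.+1) h@_(mnm2 i (m - i))).[x].
  move=> hh; rewrite {1}(homog2_expand hh) raddf_sum horner_poly /=.
  by apply: eq_bigr => i _; rewrite mevalZ mevalM !rmorphXn /= !mevalXU /= expr1n mulr1.
have E : \poly_(i < m.+1) f@_(mnm2 i (m - i)) = \poly_(i < m.+1) g@_(mnm2 i (m - i)).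
  apply/eqP; rewrite -subr_eq0; apply: contraT => /closed_nonrootP[x].
  by rewrite /root hornerD hornerN -!hpt // fg subrr eqxx.
rewrite (homog2_expand hf) (homog2_expand hg); apply: eq_bigr => i _.
by have := congr1 (fun r : {poly k} => r`_i) E; rewrite !coef_poly ltn_ord => ->.
Qed.

Lemma meval_octavic F (v : 'I_2 -> k) :
  (octavic F).@[v] = \sum_(i < 9) F`_i * (v ord0 ^+ i * v ord_max ^+ (8 - i)).
Proof.
rewrite raddf_sum /=; apply: eq_bigr => i _.
by rewrite mevalZ mevalM !rmorphXn /= !mevalXU.
Qed.

Lemma meval_subst_form M f (v : 'I_2 -> k) :
  (subst_form M f).@[v] = f.@[fun i => M i ord0 * v ord0 + M i ord_max * v ord_max].
Proof.
rewrite subst_formE comp_mpoly_meval; apply: meval_eq => i.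
rewrite tnth_mktuple !big_ord_recl big_ord0 addr0 mevalD !mevalZ !mevalXU.
by have -> : lift ord0 ord0 = ord_max :> 'I_2 by apply: val_inj.
Qed.

(** Homogenization turns a change of affine coordinate into a linear substitution. *)
Lemma subst_octavic F G rho a b c d : (size F <= 9)%N ->
    form_value 8 G (a *: 'X + b%:P) (c *: 'X + d%:P) = rho *: F ->
  exists2 M, \det M = a * d - b * c & subst_form M (octavic G) = rho *: octavic F.
Proof.
move=> sF E.
pose M : 'M[k]_2 := \matrix_(i, j)
  if i == ord0 then if j == ord0 then a else b else if j == ord0 then c else d.
exists M; first by rewrite det2 !mxE.
apply: (@homog_eval_inj 8).
- exact/subst_form_homog/octavic_homog.
- by rewrite rpredZ // octavic_homog.
move=> x; have := congr1 (fun r : {poly k} => r.[x]) E.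
rewrite hornerZ (horner_coef_wide _ sF) /form_value horner_sum => E'.
rewrite mevalZ meval_subst_form !meval_octavic.
under [in RHS]eq_bigr do rewrite /affine_pt /= expr1n mulr1.
rewrite -E'; apply: eq_bigr => i _.
by rewrite !mxE /affine_pt /= !mulr1 !hornerE.
Qed.

End OctavicInvariants.

(** * Integrality of the invariants *)

Section IntegralInvariants.

Variable k : closedFieldType.
Hypothesis char0 : [pchar k] =i pred0.
Implicit Types (f g h : {mpoly k[2]}) (I : {mpoly int[9]}).

Definition ev_inv f : {mpoly int[9]} -> k :=
  meval (octavic_coef f) \o map_mpoly (intr : int -> k).

HB.instance Definition _ f := GRing.RMorphism.on (ev_inv f).

Lemma eval_invE I f : eval_inv I f = ev_inv f I.
Proof. by []. Qed.

Lemma ev_invX f i : ev_inv f 'X_i = octavic_coef f i.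
Proof. by rewrite /ev_inv /= map_mpolyX mevalXU. Qed.

(** Phi is a rational form of degree d in the coefficients of an octavic; the factor N
    clears the denominators that the normalization of transvectants introduces. *)
Definition int_form d (Phi : {mpoly k[2]} -> k) := exists N I, [/\ (0 < N)%N,
  I \is d.-homog & forall f, f \is 8.-homog -> N%:R * Phi f = eval_inv I f].

Lemma int_form_ext d (Phi Psi : {mpoly k[2]} -> k) :
  (forall f, f \is 8.-homog -> Phi f = Psi f) -> int_form d Phi -> int_form d Psi.
Proof.
by move=> E [N [I [N0 hI EI]]]; exists N, I; split=> // f hf; rewrite -E // EI.
Qed.

Lemma int_form0 d : int_form d (fun=> 0).
Proof. by exists 1%N, 0; split=> // [|f _]; rewrite ?rpred0 // mulr0 eval_invE rmorph0. Qed.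

Lemma int_formD d Phi Psi : int_form d Phi -> int_form d Psi ->
  int_form d (fun f => Phi f + Psi f).
Proof.
move=> [N [I [N0 hI EI]]] [N' [I' [N0' hI' EI']]].
exists (N * N')%N, (I *+ N' + I' *+ N); split=> [||f hf].
- by rewrite muln_gt0 N0.
- by rewrite rpredD // rpredMn.
rewrite eval_invE rmorphD !rmorphMn /= -!eval_invE -EI // -EI' //.
by rewrite natrM -[(_ * Phi f) *+ _]mulr_natr -[(_ * Psi f) *+ _]mulr_natr; ring.
Qed.

Lemma int_formM d e Phi Psi : int_form d Phi -> int_form e Psi ->
  int_form (d + e) (fun f => Phi f * Psi f).
Proof.
move=> [N [I [N0 hI EI]]] [N' [I' [N0' hI' EI']]].
exists (N * N')%N, (I * I'); split=> [||f hf].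
- by rewrite muln_gt0 N0.
- exact: dhomogM.
rewrite eval_invE (rmorphM (ev_inv f)) /= -!eval_invE -EI // -EI' // natrM; ring.
Qed.

Lemma int_form_sum d (J : finType) (P : pred J) (Phi : J -> {mpoly k[2]} -> k) :
  (forall j, P j -> int_form d (Phi j)) -> int_form d (fun f => \sum_(j | P j) Phi j f).
Proof.
move=> hPhi.
apply: (@int_form_ext _ (fun f => \sum_(j <- index_enum J | P j) Phi j f)) => //.
elim: (index_enum J) => [|j r IH].
  by apply: int_form_ext (int_form0 d) => f _; rewrite big_nil.
have [Pj|Pj] := boolP (P j).
  apply: int_form_ext (int_formD (hPhi j Pj) IH) => f _ /=.
  by rewrite big_cons Pj.
by apply: int_form_ext IH => f _; rewrite big_cons (negPf Pj).
Qed.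

Lemma int_form_natl d n Phi : int_form d Phi -> int_form d (fun f => n%:R * Phi f).
Proof.
move=> [N [I [N0 hI EI]]]; exists N, (I *+ n); split=> // [|f hf].
  by rewrite rpredMn.
by rewrite eval_invE rmorphMn /= -eval_invE -EI // -[RHS]mulr_natr; ring.
Qed.

Lemma int_form_natX d n m Phi :
  int_form d Phi -> int_form d (fun f => n%:R ^+ m * Phi f).
Proof.
move/(int_form_natl (n ^ m)); apply: int_form_ext => f _; by rewrite natrX.
Qed.

Lemma int_form_sign d n Phi : int_form d Phi -> int_form d (fun f => (-1) ^+ n * Phi f).
Proof.
move=> [N [I [N0 hI EI]]]; exists N, ((-1) ^+ n * I); split=> // [|f hf].
  by rewrite -signr_odd; case: (odd n); rewrite ?mul1r // mulN1r rpredN.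
by rewrite eval_invE (rmorphM (ev_inv f)) rmorph_sign /= -eval_invE -EI //; ring.
Qed.

Lemma int_form_natV d n Phi : int_form d Phi -> int_form d (fun f => n%:R^-1 * Phi f).
Proof.
case: n => [|n] hPhi.
  by apply: int_form_ext (int_form0 d) => f _; rewrite invr0 mul0r.
have n0 : n.+1%:R != 0 :> k by apply: char0_natf.
have [N [I [N0 hI EI]]] := hPhi; exists (N * n.+1)%N, I; split=> // [|f hf].
  by rewrite muln_gt0 N0.
by rewrite natrM mulrA (mulfK n0) EI.
Qed.

Lemma int_form_coef (e : 'X_{1..2}) : int_form 1 (fun f => f@_e).
Proof.
have [e8|e8] := eqVneq (mdeg e) 8%N; last first.
  apply: int_form_ext (int_form0 1) => f hf.
  by rewrite (dhomog_nemf_coeff hf e8).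
have e0 : (e ord0 < 9)%N.
  by rewrite ltnS -e8 [e in mdeg e]mono2E mdeg_mono2 leq_addr.
exists 1%N, 'X_(Ordinal e0); split=> // [|f hf].
  by rewrite dhomogX; apply/eqP; apply: mdeg1.
rewrite mul1r eval_invE ev_invX /octavic_coef /=; congr (_ @_ _).
by rewrite -e8 [e in mdeg e]mono2E mdeg_mono2 addKn -/(mnm2 _ _) -mono2E.
Qed.

(** The coefficients of a transvectant are rational combinations of products of one
    coefficient of each argument. *)
Lemma int_form_transvection d d' (A B : {mpoly k[2]} -> {mpoly k[2]}) m p n :
    (forall e, int_form d (fun f => (A f)@_e)) ->
    (forall e, int_form d' (fun f => (B f)@_e)) ->
  forall e, int_form (d + d') (fun f => (transvection m p (A f) (B f) n)@_e).
Proof.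
move=> hA hB e.
have deriv_form d0 (C : {mpoly k[2]} -> {mpoly k[2]}) a b e' :
    (forall e, int_form d0 (fun f => (C f)@_e)) ->
    int_form d0 (fun f => ((C f)^`M(ord0, a)^`M(ord_max, b))@_e').
  move=> hC; set u1 := (U_(ord0) *+ a)%MM; set u2 := (U_(ord_max) *+ b)%MM.
  have := int_form_natl
    ((\prod_(i < 2) ((u1 + (u2 + e'))%MM i) ^_ (u1 i)) *
     (\prod_(i < 2) ((u2 + e')%MM i) ^_ (u2 i))) (hC (u1 + (u2 + e'))%MM).
  apply: int_form_ext => f _.
  by rewrite !mcoeff_mderivm -mulrnA mulr_natl.
pose c := (((m - n)`! * (p - n)`!)%N%:R / (m`! * p`!)%N%:R : k).
apply: (@int_form_ext _ (fun f => c * \sum_(i < n.+1) ((-1) ^+ i * ('C(n, i)%:R *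
    ((A f)^`M(ord0, (n - i)%N)^`M(ord_max, i)
      * (B f)^`M(ord0, i)^`M(ord_max, (n - i)%N))@_e)))).
  move=> f _; rewrite /transvection mcoeffZ raddf_sum /=; congr (_ * _).
  by apply: eq_bigr => i _; rewrite mcoeffZ mulrA.
apply: (@int_form_ext _ (fun f => ((m - n)`! * (p - n)`!)%N%:R *
   ((m`! * p`!)%N%:R^-1 * \sum_(i < n.+1) ((-1) ^+ i * ('C(n, i)%:R *
    ((A f)^`M(ord0, (n - i)%N)^`M(ord_max, i)
      * (B f)^`M(ord0, i)^`M(ord_max, (n - i)%N))@_e))))).
  by move=> f _; rewrite mulrA.
apply/int_form_natl/int_form_natV/int_form_sum => i _.
apply/int_form_sign/int_form_natl.
apply: int_form_ext (int_form_sum _) => [f _|].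
  by rewrite mcoeffM.
by move=> j _; apply: int_formM; apply: deriv_form.
Qed.

Lemma int_form_kappa e : int_form 2 (fun f => (kappa f)@_e).
Proof.
exact: (@int_form_transvection 1 1 id id 8 8 6 int_form_coef int_form_coef).
Qed.

Lemma int_form_hform e : int_form 4 (fun f => (hform f)@_e).
Proof.
exact: (@int_form_transvection 2 2 _ _ 4 4 2 int_form_kappa int_form_kappa).
Qed.

Lemma int_form_J2 : int_form 2 (@J2 k).
Proof.
have h := @int_form_transvection 1 1 id id 8 8 8 int_form_coef int_form_coef 0%MM.
apply: int_form_ext (int_form_natX 2 2 (int_form_natl 5 (int_form_natl 7 h))) => f _.
by rewrite /J2 !mulrA.
Qed.

Lemma int_form_J4 : int_form 4 (@J4 k).
Proof.
have h := @int_form_transvection 2 2 _ _ 4 4 4 int_form_kappa int_form_kappa 0%MM.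
apply: int_form_ext (int_form_natX 2 9 (int_form_natl 3 (int_form_natX 7 4 h))) => f _.
by rewrite /J4 !mulrA.
Qed.

Lemma int_form_J6 : int_form 6 (@J6 k).
Proof.
have h := @int_form_transvection 2 4 _ _ 4 4 4 int_form_kappa int_form_hform 0%MM.
apply: int_form_ext (int_form_natX 2 14 (int_form_natX 3 2 (int_form_natX 7 6 h))) => f _.
by rewrite /J6 !mulrA.
Qed.

Lemma int_form_invariant d w Phi N I : (0 < N)%N -> I \is d.-homog ->
    (forall f, f \is 8.-homog -> N%:R * Phi f = eval_inv I f) ->
    (forall M f, f \is 8.-homog -> Phi (subst_form M f) = \det M ^+ w * Phi f) ->
  octavic_invariant k d I.
Proof.
move=> N0 hI EI inv; split=> // M f hf d1.
by rewrite -!EI // ?inv ?d1 ?expr1n ?mul1r //; apply: subst_form_homog.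
Qed.

Lemma octavic_invariantM d e I I' : octavic_invariant k d I ->
  octavic_invariant k e I' -> octavic_invariant k (d + e) (I * I').
Proof.
move=> [hI EI] [hI' EI']; split; first exact: dhomogM.
by move=> M f hf d1; rewrite !eval_invE !rmorphM /= -!eval_invE EI // EI'.
Qed.

Lemma octavic_invariantMn d n I : octavic_invariant k d I ->
  octavic_invariant k d (I *+ n).
Proof.
move=> [hI EI]; split; first by rewrite rpredMn.
by move=> M f hf d1; rewrite !eval_invE !rmorphMn /= -!eval_invE EI.
Qed.

Lemma t4_absolute (F : {poly k}) : J2 (octavic F) * J4 (octavic F) != 0 ->
  absolute_invariant F (t4 F).
Proof.
move=> J0; have hF := octavic_homog F.
have [N2 [I2 [N20 hI2 E2]]] := int_form_J2.
have [N4 [I4 [N40 hI4 E4]]] := int_form_J4.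
have [N6 [I6 [N60 hI6 E6]]] := int_form_J6.
have nat0 n : (0 < n)%N -> n%:R != 0 :> k by case: n => // n _; apply: char0_natf.
exists 6%N, (I6 *+ (N2 * N4)), ((I2 * I4) *+ N6).
have v6 : eval_inv (I6 *+ (N2 * N4)) (octavic F) = N6%:R * J6 (octavic F) * (N2%:R * N4%:R).
  by rewrite eval_invE rmorphMn /= -eval_invE -E6 // -[LHS]mulr_natr natrM.
have v24 : eval_inv ((I2 * I4) *+ N6) (octavic F) =
    N2%:R * J2 (octavic F) * (N4%:R * J4 (octavic F)) * N6%:R.
  by rewrite eval_invE rmorphMn rmorphM /= -!eval_invE -E2 // -E4 // -[LHS]mulr_natr.
split.
- apply: octavic_invariantMn; apply: int_form_invariant N60 hI6 E6 _ => M f hf.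
  exact: J6_subst.
- apply/octavic_invariantMn/(@octavic_invariantM 2 4).
    by apply: int_form_invariant N20 hI2 E2 _ => M f hf; apply: J2_subst.
  by apply: int_form_invariant N40 hI4 E4 _ => M f hf; apply: J4_subst.
- move: J0; rewrite v24 !mulf_eq0 !negb_or => /andP[-> ->].
  by rewrite !nat0.
rewrite /t4 v6 v24; move: J0; rewrite mulf_eq0 negb_or => /andP[J20 J40].
by field; rewrite J20 J40 !nat0.
Qed.

End IntegralInvariants.

(** * The invariants of the normal form *)

Section NormalFormInvariants.

Variable k : closedFieldType.
Hypothesis char0 : [pchar k] =i pred0.

Local Notation X := ('X_ord0 : {mpoly k[2]}).
Local Notation Z := ('X_ord_max : {mpoly k[2]}).

Lemma mderiv_monomial i j a b : (X ^+ i * Z ^+ j)^`M(ord0, a)^`M(ord_max, b) =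
  (i ^_ a * j ^_ b)%:R *: (X ^+ (i - a) * Z ^+ (j - b)).
Proof.
have mono2_1 i' j' : mnm2 i' j' ord_max = j'.
  by rewrite mnmDE !mulmnE !mnm1E /= mul0n mul1n.
have sub0 i' j' c : (mnm2 i' j' - U_(ord0) *+ c)%MM = mnm2 (i' - c) j'.
  by rewrite [LHS]mono2E !mnmBE mono2_0 mono2_1 !mulmnE !mnm1E /= mul1n mul0n subn0.
have sub1 i' j' c : (mnm2 i' j' - U_(ord_max) *+ c)%MM = mnm2 i' (j' - c).
  by rewrite [LHS]mono2E !mnmBE mono2_0 mono2_1 !mulmnE !mnm1E /= mul1n mul0n subn0.
rewrite -!mpolyX_mono2 mderivnX sub0 mderivmZ mderivnX sub1 mono2_0 mono2_1.
by rewrite scalerA natrM.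
Qed.

Definition octavic_t (t : k) : {poly k} := t *: 'X^8 + t *: 'X^4 + 1.

Lemma octavic_tE t : octavic (octavic_t t) =
  t *: (X ^+ 8 * Z ^+ 0) + t *: (X ^+ 4 * Z ^+ 4) + X ^+ 0 * Z ^+ 8.
Proof.
rewrite /octavic /octavic_t !big_ord_recr big_ord0 /=.
rewrite !(coefD, coefZ, coefXn, coefC) /= !(mulr0, mulr1, add0r, addr0, scale0r, scale1r).
by rewrite addrC addrA addrC; ring.
Qed.

Lemma mderiv_octavic_t t a b n1 n2 n3 :
    (8 ^_ a * 0 ^_ b = n1)%N -> (4 ^_ a * 4 ^_ b = n2)%N -> (0 ^_ a * 8 ^_ b = n3)%N ->
  (octavic (octavic_t t))^`M(ord0, a)^`M(ord_max, b) =
    (t * n1%:R) *: (X ^+ (8 - a) * Z ^+ (0 - b)) +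
    (t * n2%:R) *: (X ^+ (4 - a) * Z ^+ (4 - b)) +
    n3%:R *: (X ^+ (0 - a) * Z ^+ (8 - b)).
Proof.
move=> <- <- <-.
by rewrite octavic_tE !mderivmD !mderivmZ !mderiv_monomial !scalerA.
Qed.

Let scalerM (a b : k) (p q : {mpoly k[2]}) : (a *: p) * (b *: q) = (a * b) *: (p * q).
Proof. by rewrite -scalerAl -scalerAr scalerA. Qed.

Let nat_neq0 n : n.+1%:R != 0 :> k.
Proof. exact: char0_natf. Qed.

(** In the sum over i, the terms i = 0, 6 give 2 t X^2 Z^2, the terms i = 2, 3, 4 give
    - (50 / 70^2) t^2 X^2 Z^2, and the others vanish. *)
Lemma kappa_octavic_t t : kappa (octavic (octavic_t t)) =
  (t * (196%:R - t) / 98%:R) *: (X ^+ 2 * Z ^+ 2).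
Proof.
pose f := octavic (octavic_t t).
have [N EN] : exists N, N = (8 ^_ 6)%N by exists (8 ^_ 6)%N.
pose c : k := N%:R.
have Ec : c = 70%:R * 288%:R.
  rewrite /c EN (ffactnD 8 4 2) natrM -[(8 ^_ 4)%N]/(70 * 24)%N natrM.
  by rewrite -[((8 - 4) ^_ 2)%N]/12%N -mulrA -(natrM _ 24).
have D0 : f^`M(ord0, 6)^`M(ord_max, 0) = (t * c) *: X ^+ 2.
  by rewrite 
    (@mderiv_octavic_t t 6 0 _ _ _ (etrans (muln1 (8 ^_ 6)) (esym EN))
      (erefl 0%N) (erefl 0%N)) !mulr0 !scale0r !addr0 mulr1.
have D1 : f^`M(ord0, 5)^`M(ord_max, 1) = 0.
  by rewrite 
    (@mderiv_octavic_t t 5 1 0 0 0) // !mulr0 !scale0r !addr0.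
have D2 : f^`M(ord0, 4)^`M(ord_max, 2) = (t * 288%:R) *: Z ^+ 2.
  by rewrite 
    (@mderiv_octavic_t t 4 2 0 288 0) // !mulr0 !scale0r addr0 add0r mul1r.
have D3 : f^`M(ord0, 3)^`M(ord_max, 3) = (t * 576%:R) *: (X * Z).
  by rewrite 
    (@mderiv_octavic_t t 3 3 0 576 0) // !mulr0 !scale0r addr0 add0r.
have D4 : f^`M(ord0, 2)^`M(ord_max, 4) = (t * 288%:R) *: X ^+ 2.
  by rewrite 
    (@mderiv_octavic_t t 2 4 0 288 0) // !mulr0 !scale0r addr0 add0r mulr1.
have D5 : f^`M(ord0, 1)^`M(ord_max, 5) = 0.
  by rewrite 
    (@mderiv_octavic_t t 1 5 0 0 0) // !mulr0 !scale0r !addr0.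
have D6 : f^`M(ord0, 0)^`M(ord_max, 6) = c *: Z ^+ 2.
  by rewrite 
    (@mderiv_octavic_t t 0 6 _ _ _ (erefl 0%N) (erefl 0%N)
      (etrans (mul1n (8 ^_ 6)) (esym EN))) !mulr0 !scale0r !add0r mul1r.
rewrite /kappa /transvection -/f !big_ord_recr big_ord0 /=.
rewrite -[(6 - 0)%N]/6%N -[(6 - 1)%N]/5%N -[(6 - 2)%N]/4%N -[(6 - 3)%N]/3%N.
rewrite -[(6 - 4)%N]/2%N -[(6 - 5)%N]/1%N -[(6 - 6)%N]/0%N.
rewrite D0 D1 D2 D3 D4 D5 D6 !mul0r !scaler0 !scalerM !scalerA.
have -> : Z ^+ 2 * X ^+ 2 = X ^+ 2 * Z ^+ 2 by rewrite mulrC.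
have -> : X * Z * (X * Z) = X ^+ 2 * Z ^+ 2 by ring.
rewrite add0r !addr0 -!scalerDl scalerA; congr (_ *: _).
have E8 : (8`!)%:R = 2%:R * c.
  have E2 : ((8 - 6)`! = 2)%N by [].
  rewrite -(ffact_fact (isT : 6 <= 8)%N) E2 -EN natrM; exact: mulrC.
rewrite [(8`! * 8`!)%:R]natrM E8 Ec.
rewrite -[((8 - 6)`! * _)%N]/4%N -['C(6, 0)]/1%N -['C(6, 2)]/15%N -['C(6, 3)]/20%N.
rewrite -['C(6, 4)]/15%N -['C(6, 6)]/1%N mulrAC.
(* The factor 288 cancels, and 7 may be treated as an indeterminate. *)
have E576 : 576%:R = 2%:R * 288%:R :> k by rewrite -natrM.
have := nat_neq0 287; rewrite E576; move: (288%:R) => s s0.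
have E70 : 70%:R = 10%:R * 7%:R :> k by rewrite -natrM.
have E98 : 98%:R = 2%:R * 7%:R ^+ 2 :> k by rewrite -natrX -natrM.
have E196 : 196%:R = 4%:R * 7%:R ^+ 2 :> k by rewrite -natrX -natrM.
have := nat_neq0 6; rewrite E70 E98 E196; move: (7%:R) => p p0.
by field; rewrite !nat_neq0 s0 p0.
Qed.

Let XZ_deriv a b n : (2 ^_ a * 2 ^_ b = n)%N ->
  (X ^+ 2 * Z ^+ 2)^`M(ord0, a)^`M(ord_max, b) = n%:R *: (X ^+ (2 - a) * Z ^+ (2 - b)).
Proof. by move=> <-; rewrite mderiv_monomial. Qed.

Lemma transvection_XZ2 : transvection 4 4 (X ^+ 2 * Z ^+ 2) (X ^+ 2 * Z ^+ 2) 2 =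
  (- 6%:R^-1) *: (X ^+ 2 * Z ^+ 2).
Proof.
rewrite /transvection !big_ord_recr big_ord0 /=.
rewrite -[(2 - 0)%N]/2%N -[(2 - 1)%N]/1%N -[(2 - 2)%N]/0%N.
rewrite (@XZ_deriv 2 0 2) // (@XZ_deriv 0 2 2) // (@XZ_deriv 1 1 4) //.
rewrite !scalerM !scalerA /= !mul1r !mulr1.
have -> : Z ^+ 2 * X ^+ 2 = X ^+ 2 * Z ^+ 2 by rewrite mulrC.
have -> : X * Z * (X * Z) = X ^+ 2 * Z ^+ 2 by ring.
rewrite add0r -!scalerDl scalerA; congr (_ *: _).
rewrite -[((4 - 2)`! * _)%N]/4%N -[(4`! * 4`!)%N]/576%N.
rewrite -['C(2, 1)]/2%N.
by field; rewrite !nat_neq0.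
Qed.

Lemma transvection_XZ4 :
  (transvection 4 4 (X ^+ 2 * Z ^+ 2) (X ^+ 2 * Z ^+ 2) 4)@_0%MM = 6%:R^-1.
Proof.
rewrite /transvection !big_ord_recr big_ord0 /=.
rewrite -[(4 - 0)%N]/4%N -[(4 - 1)%N]/3%N -[(4 - 2)%N]/2%N.
rewrite -[(4 - 3)%N]/1%N -[(4 - 4)%N]/0%N.
rewrite (@XZ_deriv 4 0 0) // (@XZ_deriv 0 4 0) // (@XZ_deriv 3 1 0) // (@XZ_deriv 1 3 0) //.
rewrite (@XZ_deriv 2 2 4) // !scale0r !mul0r !scaler0 !add0r !addr0.
rewrite scalerM !scalerA /= !mul1r mcoeffZ mcoeff1 eqxx mulr1.
rewrite -[(4`! * 4`!)%N]/576%N -['C(4, 2)]/6%N.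
by field; rewrite !nat_neq0.
Qed.

Lemma J2_octavic_t t : J2 (octavic (octavic_t t)) = 2%:R * t * (t + 140%:R).
Proof.
pose f := octavic (octavic_t t).
have [N EN] : exists N, N = (8 ^_ 8)%N by exists (8 ^_ 8)%N.
pose c : k := N%:R.
have Ec : c = 70%:R * 576%:R.
  rewrite /c EN (ffactnD 8 4 4) natrM -[(8 ^_ 4)%N]/(70 * 24)%N natrM.
  by rewrite -[((8 - 4) ^_ 4)%N]/24%N -mulrA -(natrM _ 24).
have D0 : f^`M(ord0, 8)^`M(ord_max, 0) = (t * c) *: 1.
  by rewrite 
    (@mderiv_octavic_t t 8 0 _ _ _ (etrans (muln1 (8 ^_ 8)) (esym EN))
      (erefl 0%N) (erefl 0%N)) !mulr0 !scale0r !addr0 mulr1.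
have D4 : f^`M(ord0, 4)^`M(ord_max, 4) = (t * 576%:R) *: 1.
  by rewrite 
    (@mderiv_octavic_t t 4 4 0 576 0) // !mulr0 !scale0r addr0 add0r mulr1.
have D8 : f^`M(ord0, 0)^`M(ord_max, 8) = c *: 1.
  by rewrite 
    (@mderiv_octavic_t t 0 8 _ _ _ (erefl 0%N) (erefl 0%N)
      (etrans (mul1n (8 ^_ 8)) (esym EN))) !mulr0 !scale0r !add0r mulr1.
have Dz a b : (8 ^_ a * 0 ^_ b = 0)%N -> (4 ^_ a * 4 ^_ b = 0)%N ->
    (0 ^_ a * 8 ^_ b = 0)%N -> f^`M(ord0, a)^`M(ord_max, b) = 0.
  by move=> e1 e2 e3; rewrite (mderiv_octavic_t _ e1 e2 e3) !mulr0 !scale0r !addr0.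
rewrite /J2 /transvection -/f !big_ord_recr big_ord0 /=.
rewrite -[(8 - 0)%N]/8%N -[(8 - 1)%N]/7%N -[(8 - 2)%N]/6%N -[(8 - 3)%N]/5%N.
rewrite -[(8 - 4)%N]/4%N -[(8 - 5)%N]/3%N -[(8 - 6)%N]/2%N.
rewrite -[(8 - 7)%N]/1%N -[(8 - 8)%N]/0%N.
rewrite D0 D4 D8 (Dz 7 1) // (Dz 6 2) // (Dz 5 3) // (Dz 3 5) // (Dz 2 6) // (Dz 1 7) //.
rewrite !mul0r !scaler0 !scalerM !scalerA !add0r !addr0 -!scalerDl scalerA.
rewrite mcoeffZ -['C(8, 0)]/1%N -['C(8, 4)]/70%N -['C(8, 8)]/1%N.
have -> : (1 * 1 : {mpoly k[2]})@_0%MM = 1 by rewrite mulr1 mcoeff1 eqxx.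
rewrite mulr1.
have E8 : (8`!)%:R = c by rewrite -ffactnn -EN.
rewrite [(8`! * 8`!)%:R]natrM E8 Ec.
rewrite -[(0`! * _)%N]/1%N.
have E140 : 140%:R = 2%:R * 70%:R :> k by rewrite -natrM.
have E140' : 2%:R ^+ 2 * 5%:R * 7%:R = 2%:R * 70%:R :> k by rewrite -natrX -!natrM.
have := nat_neq0 575; have := nat_neq0 69; rewrite E140 E140'.
move: (70%:R) (576%:R) => p s p0 s0.
by field; rewrite s0 p0.
Qed.

Lemma J4_octavic_t t : J4 (octavic (octavic_t t)) =
  2%:R ^+ 8 * 7%:R ^+ 4 * (t * (196%:R - t) / 98%:R) ^+ 2.
Proof.
rewrite /J4 kappa_octavic_t transvectionZ mcoeffZ transvection_XZ4.
by move: (_ / 98%:R) => m; field; rewrite !nat_neq0.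
Qed.

Lemma hform_octavic_t t : hform (octavic (octavic_t t)) =
  (- (t * (196%:R - t) / 98%:R) ^+ 2 / 6%:R) *: (X ^+ 2 * Z ^+ 2).
Proof.
rewrite /hform kappa_octavic_t transvectionZ transvection_XZ2 scalerA.
by congr (_ *: _); rewrite mulrN mulNr -expr2.
Qed.

Lemma J6_octavic_t t : J6 (octavic (octavic_t t)) =
  - (2%:R ^+ 12 * 7%:R ^+ 6 * (t * (196%:R - t) / 98%:R) ^+ 3).
Proof.
rewrite /J6 kappa_octavic_t hform_octavic_t transvectionZ mcoeffZ transvection_XZ4.
by move: (_ / 98%:R) => m; field; rewrite !nat_neq0.
Qed.

(** At t = 196 both J4 and J6 vanish; t4 is then 0 by the convention x / 0 = 0, which
    agrees with the formula. *)
Lemma t4_octavic_t t : t != 0 -> t != - 140%:R ->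
  t4 (octavic_t t) = 4%:R * (t - 196%:R) / (t + 140%:R).
Proof.
move=> t0 t140; have t140' : t + 140%:R != 0 by rewrite addr_eq0.
rewrite /t4 J6_octavic_t J4_octavic_t J2_octavic_t.
have [->|t196] := eqVneq t 196%:R; first by rewrite !subrr !(mulr0, mul0r, expr0n, oppr0).
have t196' : 196%:R - t != 0 by rewrite subr_eq0 eq_sym.
pose A : k := 2%:R ^+ 8 * 7%:R ^+ 4.
have A0 : A != 0 by rewrite mulf_neq0 ?expf_neq0 ?nat_neq0.
have -> : 2%:R ^+ 12 * 7%:R ^+ 6 = 8%:R * 98%:R * A by rewrite /A; ring.
rewrite -/A; clearbody A; have := nat_neq0 97; move: (98%:R) => q q0.
by field; rewrite A0 q0 nat_neq0 t0 t140' t196'.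
Qed.

Lemma t_of_t4 t : t != 0 -> t != - 140%:R ->
  t = - 28%:R * ((5%:R * t4 (octavic_t t) + 28%:R) / (t4 (octavic_t t) - 4%:R)).
Proof.
move=> t0 t140; rewrite t4_octavic_t //.
have t140' : t + 140%:R != 0 by rewrite addr_eq0.
have E : 4%:R * (t - 196%:R) / (t + 140%:R) - 4%:R = - 1344%:R / (t + 140%:R).
  by field.
by rewrite E; field; rewrite t140' oppr_eq0 nat_neq0.
Qed.

End NormalFormInvariants.

(** * The field of moduli *)

(** A common root x of the octavic and its derivative satisfies 2 x^4 = -1, and then the
    octavic takes the value 1 - t / 4 at x. *)
Lemma separable_octavic_t (k : closedFieldType) (t : k) : [pchar k] =i pred0 ->
  t != 0 -> t != 4%:R -> separable_poly (octavic_t t).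
Proof.
move=> char0 t0 t4; rewrite unlock; apply: Pdiv.ClosedField.root_coprimep => x.
have -> : (octavic_t t)^`() = t *: ('X^7 *+ 8) + t *: ('X^3 *+ 4).
  by rewrite !derivD !derivZ !derivXn -polyC1 derivC addr0.
rewrite /root /octavic_t !hornerD !hornerZ !hornerMn !hornerXn -polyC1 hornerC.
move=> /eqP Ex; apply/negP=> /eqP dEx.
have : (4%:R * t) * x ^+ 3 * (2%:R * x ^+ 4 + 1) = 0 by rewrite -dEx; ring.
move/eqP; rewrite mulf_eq0 => /orP[].
  rewrite mulf_eq0 => /orP[|].
    by rewrite mulf_eq0 (negPf t0) (negPf (char0_natf char0 3)).
  rewrite expf_eq0 /= => /eqP x0; move/eqP: Ex.
  by rewrite x0 !expr0n !mulr0 !add0r oner_eq0.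
rewrite addr_eq0 => /eqP x4; case/negP: t4; rewrite -subr_eq0; apply/eqP.
transitivity (t - 4%:R + 4%:R * (t * x ^+ 8 + t * x ^+ 4 + 1)).
  by rewrite Ex mulr0 addr0.
transitivity (t + t * (2%:R * x ^+ 4) ^+ 2 + 2%:R * t * (2%:R * x ^+ 4)); first by ring.
by rewrite x4; ring.
Qed.

Lemma size_octavic_t (k : closedFieldType) (t : k) : t != 0 -> size (octavic_t t) = 9%N.
Proof.
move=> t0; rewrite /octavic_t -addrA size_polyDl size_scale ?size_polyXn //.
rewrite (leq_ltn_trans (size_polyD _ _)) // size_poly1 size_scale ?size_polyXn //.
Qed.

Lemma hyp_inv_ext (k : closedFieldType) (K : fieldType) (iota : {rmorphism k -> K})
    (s s' : {rmorphism K -> K}) (u v : K) :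
  s =1 s' -> hyp_inv iota s u v -> hyp_inv iota s' u v.
Proof.
move=> E [tu sk ss sf sv v0 hg]; split=> //.
- by move=> a; rewrite -E sk.
- by move=> z; rewrite -!E ss.
- by move=> z; rewrite -E.
- by rewrite -E.
Qed.

Section Subfields.

Variables (k : fieldType) (L : k -> Prop).
Hypothesis hL : is_subfield L.

Lemma subfieldB x y : L x -> L y -> L (x - y).
Proof. by move=> Lx Ly; case: hL => _ LBV; case: (LBV x y Lx Ly). Qed.

Lemma subfield_div x y : L x -> L y -> L (x / y).
Proof. by move=> Lx Ly; case: hL => _ LBV; case: (LBV x y Lx Ly). Qed.

Lemma subfield1 : L 1.
Proof. by case: hL. Qed.

Lemma subfield0 : L 0.
Proof. by rewrite -(subrr 1); apply: subfieldB; apply: subfield1. Qed.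

Lemma subfieldN x : L x -> L (- x).
Proof. by rewrite -sub0r; apply: subfieldB; apply: subfield0. Qed.

Lemma subfieldD x y : L x -> L y -> L (x + y).
Proof. by move=> Lx Ly; rewrite -[y]opprK; apply: subfieldB => //; apply: subfieldN. Qed.

Lemma subfieldM x y : L x -> L y -> L (x * y).
Proof.
move=> Lx Ly; rewrite -[y]invrK -[y^-1]div1r.
by apply: subfield_div => //; apply: subfield_div => //; apply: subfield1.
Qed.

Lemma subfield_nat n : L n%:R.
Proof.
elim: n => [|n IH]; first exact: subfield0.
by rewrite -natr1; apply: subfieldD IH subfield1.
Qed.

Lemma coef_hyperelliptic_octavic_t (t : k) i j :
  L t -> L (hyperelliptic_eqn (t *: 'X^8 + t *: 'X^4 + 1))`_i`_j.
Proof.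
move=> Lt; have Lb (b : bool) : L b%:R := subfield_nat b.
have L0 := subfield0.
rewrite /hyperelliptic_eqn coefB coefB -polyC_exp; apply: subfieldB.
  by rewrite coefC; case: eqP => _; rewrite ?coef0 // coefXn.
rewrite coef_map /= coefC; case: eqP => _ //.
rewrite !coefD !coefZ !coefXn coef1.
by apply: subfieldD => //; apply: subfieldD => //; apply: subfieldM.
Qed.

End Subfields.

Lemma is_subfield_moduli (k : fieldType) (F : {poly k}) : is_subfield (field_of_moduli F).
Proof.
split=> [S [S1 _] //|x y Lx Ly].
by split=> S hS hF; [apply: subfieldB | apply: subfield_div]; rewrite ?hS //;
  [apply: Lx | apply: Ly | apply: Lx | apply: Ly].
Qed.

Theorem lemma7 (k : closedFieldType) (char0 : [pchar k] =i pred0)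
    (K : fieldType) (iota : {rmorphism k -> K}) (F : {poly k})
    (hC : genus3_hyperelliptic iota F)
    (hAut : full_aut_isog iota ('Z_2 * 'D_8)%type) :
  (exists t : k, [/\ t != 0, t != 4%:R
     & has_equation iota (hyperelliptic_eqn (t *: 'X^8 + t *: 'X^4 + 1))]) /\
  (forall t : k, t != 0 -> t != 4%:R ->
     has_equation iota (hyperelliptic_eqn (t *: 'X^8 + t *: 'X^4 + 1)) ->
     t != - 140%:R -> t != - (980%:R / 3%:R) ->
     t = - 28%:R * ((5%:R * t4 F + 28%:R) / (t4 F - 4%:R)) /\
     is_field_of_definition iota (field_of_moduli F)).
Proof.
have [phi [aut phiM phi_inj phi_surj]] := hAut.
have [sepF sF [u [v /plane_model_hyp_model M]]] := hC.
have sF7 : (7 < size F)%N by case/orP: sF => /eqP->.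
have sF9 : (size F <= 9)%N by case/orP: sF => /eqP->.
have hg := separable_high_genus char0 M sepF sF7.
have [s [sb Hs]] := hyp_model_inv char0 M hg.
have [g0 Eg0] := phi_surj s sb (hyp_k Hs).
have Hg0 : hyp_inv iota (phi g0) u v by apply: hyp_inv_ext Hs => z; rewrite Eg0.
have card_G : (8 < #|('Z_2 * 'D_8 : finGroupType)%type|)%N by rewrite card_Z2D8.
split.
  have [t [t0 t4 [x [y Mt]]]] :=
    normal_form char0 expg4_Z2D8 card_G aut phiM phi_inj phi_surj M hg sF9 Hg0.
  by exists t; split=> //; exists x, y; apply/plane_model_hyp_model.
move=> t t0 t4' eqt t140 _; have [x [y /plane_model_hyp_model Mt]] := eqt.
rewrite -/(octavic_t t) in Mt.
have hgx := separable_high_genus char0 Mt (separable_octavic_t char0 t0 t4').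
rewrite size_octavic_t // in hgx; have {}hgx := hgx isT.
have [s' [_ Hs']] := hyp_model_inv char0 Mt hgx.
have Ess' := hyp_inv_unique_aut char0 expg4_Z2D8 phiM phi_surj Hs Hs'.
have ux : sameRat iota u x.
  split.
    by apply/(hyp_fix Hs); rewrite Ess'; apply/(hyp_fix Hs')/inRat_id.
  by apply/(hyp_fix Hs'); rewrite -Ess'; apply/(hyp_fix Hs)/inRat_id.
have [a [b [c [d [det0 Q0 Ex]]]]] := moebius_of_mutual char0 (hm_transc M) ux.1 ux.2.
have [|rho rho0 EG] := moebius_transfer char0 M Mt hg sF9 _ ux Q0 Ex.
  by rewrite size_octavic_t.
have [A detA EA] := subst_octavic sF9 EG.
rewrite -detA in det0.
have Et4 : t4 F = t4 (octavic_t t) := t4_equivalent char0 rho0 det0 EA.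
have Et : t = - 28%:R * ((5%:R * t4 F + 28%:R) / (t4 F - 4%:R)).
  by rewrite Et4; apply: t_of_t4.
split; first exact: Et.
split; first exact: is_subfield_moduli.
exists (hyperelliptic_eqn (t *: 'X^8 + t *: 'X^4 + 1)); split; last exact: eqt.
move=> i j.
apply: (@coef_hyperelliptic_octavic_t _ (field_of_moduli F)).
  exact: is_subfield_moduli.
(* At t = 196 there is no absolute invariant t4 to rely on, but t is an integer. *)
move=> S hS hF; have SN n := subfield_nat hS n.
have [->|t196] := eqVneq t 196%:R; first exact: SN.
have S4 : S (t4 F).
  apply: hF; apply: (t4_absolute char0).
  have hG := octavic_homog (octavic_t t).
  have E2 := J2_subst char0 A hG; have E4 := J4_subst char0 A hG.
  rewrite EA J2Z (J2_octavic_t char0) in E2; rewrite EA J4Z (J4_octavic_t char0) in E4.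
  move: (J2 (octavic F)) (J4 (octavic F)) E2 E4 => j2 j4 E2 E4.
  have n0 n : n.+1%:R != 0 :> k := char0_natf char0 n.
  have t140' : t + 140%:R != 0 by rewrite addr_eq0.
  have t196' : 196%:R - t != 0 by rewrite subr_eq0 eq_sym.
  have : (rho ^+ 2 * j2) * (rho ^+ 4 * j4) != 0.
    by rewrite E2 E4 !mulf_neq0 ?expf_neq0 ?mulf_neq0 ?invr_eq0.
  by rewrite mulrACA mulf_eq0 negb_or => /andP[].
move: (t4 F) S4 Et => tau Stau ->.
apply: (subfieldM hS); first exact/(subfieldN hS)/SN.
apply: (subfield_div hS); last exact: (subfieldB hS Stau (SN 4)).
by apply: (subfieldD hS); [apply: (subfieldM hS) | apply: SN].
Qed.
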